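(* The $\mathrm{GL}(4)$ tensor product algebra $\mathrm{TA}(4)$ is generated as a $\mathbb{C}$-algebra by the following twenty polynomials: \begin{align*} &g_1=\Delta_0(1),\quad g_2=\Delta_0(1,2),\quad g_3=\Delta_0(1,2,3),\quad g_4=\Delta_0(1,2,3,4),\\ &g_5=\Delta_1(\,),\quad g_6=\Delta_1(1),\quad g_7=\Delta_1(1,2),\quad g_8=\Delta_1(1,2,3),\\ &g_9=\Delta_2(\,),\quad g_{10}=\Delta_2(1),\quad g_{11}=\Delta_2(1,2),\\ &g_{12}=\Delta_3(\,),\quad g_{13}=\Delta_3(1),\quad g_{14}=\Delta_4(\,),\\ &g_{15}=\Delta_2(2)\Delta_0(1)-\Delta_2(1)\Delta_0(2),\\ &g_{16}=\Delta_2(2,3)\Delta_0(1)-\Delta_2(1,3)\Delta_0(2)+\Delta_2(1,2)\Delta_0(3),\\ &g_{17}=\Delta_2(1,3)\Delta_0(1,2)-\Delta_2(1,2)\Delta_0(1,3),\\ &g_{18}=\Delta_3(2)\Delta_0(1)-\Delta_3(1)\Delta_0(2),\\ &g_{19}=\Delta_3(3)\Delta_0(1,2)-\Delta_3(2)\Delta_0(1,3)+\Delta_3(1)\Delta_0(2,3),\\ &g_{20}=\Delta_3(2)\Delta_1(1)-\Delta_3(1)\Delta_1(2), \end{align*} with the fifteen basic relations $\hat r_j=0$ ($1\le j\le 15$) among them (that is, these relations hold and generate the ideal of all polynomial relations among $g_1,\ldots,g_{20}$), where \begin{align*} &\hat r_1=g_1g_7g_9-g_6g_{15}+g_2g_5g_{10},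 && \hat r_2=g_1g_8g_9-g_6g_{16}+g_5g_{17},\\ &\hat r_3=g_1g_{11}g_{12}-g_{10}g_{18}+g_{13}g_{15}, && \hat r_4=g_6g_{11}g_{12}-g_{10}g_{20}+g_7g_9g_{13},\\ &\hat r_5=g_2g_8g_{10}-g_7g_{17}+g_3g_6g_{11}, && \hat r_6=g_2g_8g_{12}-g_7g_{19}+g_3g_{20},\\ &\hat r_7=g_6g_{18}-g_1g_{20}-g_2g_5g_{13}, && \hat r_8=g_7g_{16}-g_8g_{15}-g_3g_5g_{11},\\ &\hat r_9=g_{10}g_{19}-g_{12}g_{17}-g_3g_9g_{13}, && \hat r_{10}=g_{15}g_{17}-g_2g_{10}g_{16}-g_1g_3g_9g_{11},\\ &\hat r_{11}=g_{15}g_{19}-g_2g_{12}g_{16}-g_3g_9g_{18}, && \hat r_{12}=g_{15}g_{20}-g_7g_9g_{18}-g_2g_5g_{11}g_{12},\\ &\hat r_{13}=g_{16}g_{20}-g_5g_{11}g_{19}-g_8g_9g_{18}, && \hat r_{14}=g_{17}g_{20}-g_6g_{11}g_{19}-g_2g_8g_9g_{13},\\ &\hat r_{15}=g_{17}g_{18}-g_1g_{11}g_{19}-g_2g_{13}g_{16}. \end{align*} Here $\Delta_i(j_1,\ldots,j_k)$ denotes the minor defined in the context, with $n=4$.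
   Context: Let $M_n$ be the space of $n\times n$ complex matrices. On $M_n\oplus M_n$ use coordinates $(x_{ij})$ on the first summand and $(y_{ij})$ on the second, so that $\mathbb{C}[M_n\oplus M_n]=\mathbb{C}[x_{ij},y_{ij}:1\le i,j\le n]$. The group $\mathrm{GL}(n)^3$, with $\mathrm{GL}(n)=\mathrm{GL}_n(\mathbb{C})$, acts on $\mathbb{C}[M_n\oplus M_n]$ by \[ (g\cdot f)(m_1,m_2)=f(g_1^tm_1g_2,\;g_1^tm_2g_3),\qquad g=(g_1,g_2,g_3). \] Let $U_n\subset\mathrm{GL}(n)$ be the subgroup of upper triangular matrices with $1$'s on the diagonal. The $\mathrm{GL}(n)$ tensor product algebra is the invariant algebra \[ \mathrm{TA}(n)=\mathbb{C}[M_n\oplus M_n]^{U_n\times U_n\times U_n}. \] Minors: consider the $n\times 2n$ matrix $[\,x\,|\,y\,]$ whose first $n$ columns are those of $(x_{ij})$ and whose last $n$ columns are those of $(y_{ij})$. For $i\ge0$ and $1\le j_1<\cdots<j_k\le n$ (with $k\ge 0$ and $1\le i+k\le n$), $\Delta_i(j_1,\ldots,j_k)$ denotes the determinant of the $(i+k)\times(i+k)$ submatrix with rows $1,2,\ldots,i+k$ and columns $1,2,\ldots,i,n+j_1,\ldots,n+j_k$. (In the paper this determinant is denoted by the one-column tableau having $i$ empty boxes followed by boxes with entries $j_1,\ldots,j_k$.) For $k=0$ we write $\Delta_i(\,)$. *)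

(* Defs.v *)
From HB Require Import structures.
From mathcomp Require Import all_boot all_order all_algebra.
From mathcomp Require Import reals.
From mathcomp Require Import complex mpoly.

Set Implicit Arguments.
Unset Strict Implicit.
Unset Printing Implicit Defensive.

Import GRing.Theory.
Local Open Scope ring_scope.

(* C[M_n (+) M_n]: polynomials in n * n + n * n variables, the x_ij first (in
   row-major order), then the y_ij. *)
Notation polyMM F n := {mpoly F[n * n + n * n]}.

Section TensorProductAlgebra.
Variables (F : fieldType) (n : nat).

Definition xmx : 'M[polyMM F n]_n :=
  \matrix_(i, j) 'X_(lshift (n * n) (mxvec_index i j)).
Definition ymx : 'M[polyMM F n]_n :=
  \matrix_(i, j) 'X_(rshift (n * n) (mxvec_index i j)).

(* The coordinates of (m1, m2), numbered like the variables above. *)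
Definition coords (A : nzRingType) (m1 m2 : 'M[A]_n) :
    'I_(n * n + n * n) -> A :=
  fun k => row_mx (mxvec m1) (mxvec m2) 0 k.

(* The action of (g1, g2, g3), given by the substitution of g1^T x g2 for x and
   of g1^T y g3 for y; see [meval_act] below.  The formula makes sense for all
   matrices, and is an action of GL(n)^3 for the invertible ones. *)
Definition act (g1 g2 g3 : 'M[F]_n) (f : polyMM F n) : polyMM F n :=
  let c (g : 'M[F]_n) : 'M[polyMM F n]_n := map_mx (@mpolyC _ F) g in
  f \mPo mktuple (coords ((c g1)^T *m xmx *m c g2) ((c g1)^T *m ymx *m c g3)).

Definition unitriangular (u : 'M[F]_n) : Prop :=
  forall i j : 'I_n, (j <= i)%N -> u i j = (i == j)%:R.

Definition TA (f : polyMM F n) : Prop :=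
  forall u1 u2 u3 : 'M[F]_n,
    unitriangular u1 -> unitriangular u2 -> unitriangular u3 ->
    act u1 u2 u3 f = f.

Lemma unitriangular_unit (u : 'M[F]_n) : unitriangular u -> u \in unitmx.
Proof.
move=> uU; rewrite unitmxE -det_tr det_trig; last first.
  apply/is_trig_mxP => i j lt_ij; rewrite mxE uU ?(ltnW lt_ij) //.
  by rewrite -val_eqE /= gtn_eqF.
by rewrite big1 ?unitr1 // => i _; rewrite mxE uU // eqxx.
Qed.

Lemma meval_xmx (m1 m2 : 'M[F]_n) :
  map_mx (meval (coords m1 m2)) xmx = m1.
Proof.
apply/matrixP => i j; rewrite !mxE mevalXU /coords row_mxEl.
by rewrite mxvecE.
Qed.

Lemma meval_ymx (m1 m2 : 'M[F]_n) :
  map_mx (meval (coords m1 m2)) ymx = m2.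
Proof.
apply/matrixP => i j; rewrite !mxE mevalXU /coords row_mxEr.
by rewrite mxvecE.
Qed.

Lemma meval_act (g1 g2 g3 : 'M[F]_n) (f : polyMM F n) (m1 m2 : 'M[F]_n) :
  (act g1 g2 g3 f).@[coords m1 m2] =
  f.@[coords (g1^T *m m1 *m g2) (g1^T *m m2 *m g3)].
Proof.
rewrite /act comp_mpoly_meval; apply: meval_eq => k.
have evC (g : 'M[F]_n) :
    map_mx (meval (coords m1 m2)) (map_mx (@mpolyC (n * n + n * n) F) g) = g.
  by apply/matrixP => i j; rewrite !mxE mevalC.
rewrite tnth_mktuple /coords.
have evE (P : 'rV[polyMM F n]_(n * n + n * n)) :
    (P 0 k).@[coords m1 m2] = map_mx (meval (coords m1 m2)) P 0 k.
  by rewrite mxE.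
rewrite evE map_row_mx !map_mxvec !map_mxM -!map_trmx !evC.
by rewrite meval_xmx meval_ymx.
Qed.

End TensorProductAlgebra.

(* The minor Delta_i(j_1, ..., j_k) of [x | y], for matrices of size n.+1.
   The j's are numbered from 1 to n.+1, as on paper, while ordinals start at 0;
   it is meaningful for i + size js <= n.+1 and 1 <= j <= n.+1 only. *)
Definition Delta (F : fieldType) (n i : nat) (js : seq nat) :
    polyMM F n.+1 :=
  let col (b : nat) : 'I_(n.+1 + n.+1) :=
    if (b < i)%N then lshift n.+1 (inord b)
    else rshift n.+1 (inord (nth 0%N js (b - i)).-1) in
  \det (\matrix_(a < i + size js, b < i + size js)
          row_mx (xmx F n.+1) (ymx F n.+1) (inord a) (col b)).

Section TA4.
Variable F : fieldType.

Local Notation D i js := (@Delta F 3 i%N js%N).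

Definition TA4_gens : 20.-tuple (polyMM F 4) :=
  [tuple D 0 [:: 1]; D 0 [:: 1; 2]; D 0 [:: 1; 2; 3]; D 0 [:: 1; 2; 3; 4];
         D 1 [::]; D 1 [:: 1]; D 1 [:: 1; 2]; D 1 [:: 1; 2; 3];
         D 2 [::]; D 2 [:: 1]; D 2 [:: 1; 2];
         D 3 [::]; D 3 [:: 1]; D 4 [::];
         D 2 [:: 2] * D 0 [:: 1] - D 2 [:: 1] * D 0 [:: 2];
         D 2 [:: 2; 3] * D 0 [:: 1] - D 2 [:: 1; 3] * D 0 [:: 2]
           + D 2 [:: 1; 2] * D 0 [:: 3];
         D 2 [:: 1; 3] * D 0 [:: 1; 2] - D 2 [:: 1; 2] * D 0 [:: 1; 3];
         D 3 [:: 2] * D 0 [:: 1] - D 3 [:: 1] * D 0 [:: 2];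
         D 3 [:: 3] * D 0 [:: 1; 2] - D 3 [:: 2] * D 0 [:: 1; 3]
           + D 3 [:: 1] * D 0 [:: 2; 3];
         D 3 [:: 2] * D 1 [:: 1] - D 3 [:: 1] * D 1 [:: 2]].

(* The formal variable standing for the j-th generator, 1 <= j <= 20. *)
Local Notation g j := ('X_(@inord 19 j%N.-1) : {mpoly F[20]}).

Definition TA4_rels : 15.-tuple {mpoly F[20]} :=
  [tuple
    g 1 * g 7 * g 9 - g 6 * g 15 + g 2 * g 5 * g 10;
    g 1 * g 8 * g 9 - g 6 * g 16 + g 5 * g 17;
    g 1 * g 11 * g 12 - g 10 * g 18 + g 13 * g 15;
    g 6 * g 11 * g 12 - g 10 * g 20 + g 7 * g 9 * g 13;
    g 2 * g 8 * g 10 - g 7 * g 17 + g 3 * g 6 * g 11;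
    g 2 * g 8 * g 12 - g 7 * g 19 + g 3 * g 20;
    g 6 * g 18 - g 1 * g 20 - g 2 * g 5 * g 13;
    g 7 * g 16 - g 8 * g 15 - g 3 * g 5 * g 11;
    g 10 * g 19 - g 12 * g 17 - g 3 * g 9 * g 13;
    g 15 * g 17 - g 2 * g 10 * g 16 - g 1 * g 3 * g 9 * g 11;
    g 15 * g 19 - g 2 * g 12 * g 16 - g 3 * g 9 * g 18;
    g 15 * g 20 - g 7 * g 9 * g 18 - g 2 * g 5 * g 11 * g 12;
    g 16 * g 20 - g 5 * g 11 * g 19 - g 8 * g 9 * g 18;
    g 17 * g 20 - g 6 * g 11 * g 19 - g 2 * g 8 * g 9 * g 13;
    g 17 * g 18 - g 1 * g 11 * g 19 - g 2 * g 13 * g 16].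

End TA4.

Definition subalgebra_gen (F : fieldType) (k m : nat)
    (g : m.-tuple {mpoly F[k]}) (f : {mpoly F[k]}) : Prop :=
  exists P : {mpoly F[m]}, f = P \mPo g.

Definition ideal_gen (F : fieldType) (m l : nat)
    (r : l.-tuple {mpoly F[m]}) (P : {mpoly F[m]}) : Prop :=
  exists c : 'I_l -> {mpoly F[m]}, P = \sum_(j < l) c j * tnth r j.

(* Main.v *)
Require Import Defs.
From mathcomp Require Import all_boot all_order all_algebra.
From mathcomp Require Import reals.
From mathcomp Require Import complex mpoly.
From mathcomp Require Import ring zify.

(** Write g_1, ..., g_20 for the generators, A for the invariant algebra and B for the
    subalgebra of A that they generate.  The proof compares A with B on a slice, and controls
    B by the combinatorics of a cluster algebra of type A_3.

    Slice.  If the six pivots g_1, g_2, g_3, g_5, g_9, g_12 (the leading minors of orders 1, 2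
    and 3 of y and of x) do not vanish at a pair (x, y), Gaussian elimination moves the pair by
    unitriangular matrices to a pair with x diagonal and y lower triangular ([to_slice]).  So an
    invariant is determined by its values on the slice ([TA_eq0_on_slice]), where the
    generators are short explicit polynomials; this proves the relations
    ([exchange_gens]).  The fourteen coordinates on the slice are Laurent monomials in the
    generators, with only pivots in the denominators ([slice_coords]); hence a power of the
    product of the pivots moves any invariant into B ([TA_localized]).

    Straightening.  Up to sign, each relation has the form X_a X_b = M_1 + M_2 with monomials
    M_1 and M_2.  The nine variables that occur as X_a or X_b correspond to the diagonals of a
    hexagon, and the fifteen products X_a X_b to the pairs of crossing diagonals.  A monomial is
    standard if no two crossing variables divide it.  Modulo the relations every polynomial is
    a combination of standard monomials ([straighten]), because the weights 2 for a short
    diagonal, 3 for a long one and 0 for the eleven other variables drop from X_a X_b to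
    M_1 and M_2.  None of the pivots occurs in a crossing pair.

    Independence on the pivot divisors.  For each pivot g_i, the standard monomials in the other
    generators are linearly independent on the hypersurface g_i = 0 ([pivot_indep]).  To see
    this, parametrize part of the hypersurface by an explicit family of sparse
    matrices in thirteen variables: in these charts the standard monomials without g_i have
    pairwise distinct leading monomials.  The exponents of the leading monomials are linear in
    the exponents of the g_j, and injectivity is checked on each pair of the fourteen clusters,
    that is, of the triangulations of the hexagon.

    Conclusion.  If g_i f lies in B for a pivot g_i and a polynomial f, write it as the value of
    X_i Q_1 + Q_0, where both terms are standard and Q_0 does not involve X_i.  Then Q_0 vanishes
    on g_i = 0, so Q_0 = 0 and f is the value of Q_1 ([pivot_saturated]).  Dividing by the
    pivots one at a time gives A = B ([TA_generated]).  The same splitting, used with i = 1,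
    shows that the standard monomials are linearly independent ([standard_indep]), so that every
    relation straightens to 0 and lies in the ideal ([relations_generate]). *)

Set Implicit Arguments.
Unset Strict Implicit.
Unset Printing Implicit Defensive.

Import Order.TTheory GRing.Theory.
Local Open Scope ring_scope.

(** * Polynomials vanishing at every point *)

Lemma poly_vanish (K : idomainType) (p : {poly K}) :
  injective (fun n : nat => n%:R : K) -> (forall n : nat, p.[n%:R] = 0) -> p = 0.
Proof.
move=> K0 p0; apply/eqP/negP => /negP pn0.
pose s := [seq n%:R : K | n <- iota 0 (size p)].
have := max_poly_roots pn0 (rs := s).
rewrite size_map size_iota ltnn map_inj_uniq ?iota_uniq // => h.
suff: false by []; apply: h => //.
by apply/allP => _ /mapP[n _ ->]; rewrite /root p0.
Qed.

(** Evaluating all variables but the last in [muni p], a polynomial in the last variable, and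
    then the last one, evaluates p. *)
Lemma muni_horner (K : comNzRingType) n (p : {mpoly K[n.+1]}) (v : 'I_n.+1 -> K) :
  p.@[v] = (map_poly (meval (v \o widen_ord (leqnSn n))) (muni p)).[v ord_max].
Proof.
rewrite muniE mevalE rmorph_sum horner_sum /=; apply: eq_bigr => m _.
rewrite -!mul_polyC.
rewrite !rmorphM /= !map_polyC /= map_polyXn hornerM hornerC hornerXn.
rewrite mevalZ mevalX.
rewrite big_ord_recr /= mulrA; congr (_ * _ * _).
by apply: eq_bigr => i _; rewrite mnmE.
Qed.

Lemma muni_eq0 (K : comNzRingType) n (p : {mpoly K[n.+1]}) : muni p = 0 -> p = 0.
Proof.
move=> p0; apply/mpolyP => m; rewrite mcoeff0.
have := congr1 (fun q : {poly {mpoly K[n]}} =>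
  (q`_(m ord_max))@_[multinom m (widen_ord (leqnSn n) i) | i < n]) p0.
rewrite /= coef0 mcoeff0 muniE coef_sum raddf_sum /= => <-.
rewrite {1}[p]mpolyE raddf_sum /=; apply: eq_bigr => m' _.
rewrite -!mul_polyC !coefCM -scalerAl !mcoeffZ mcoeffX coefXn.
congr (_ * _); rewrite [in RHS]mulr_natr.
have [<-|ne] := eqVneq m' m; first by rewrite eqxx mcoeffMn mcoeffX eqxx.
rewrite mcoeffMn mcoeffX; case: eqP => [e1|]; last by rewrite mul0rn.
case: eqP => [e2|]; last by rewrite mulr0n.
case/eqP: ne; apply/mnmP => i; have [->|ne] := eqVneq i ord_max; first by [].
have lt_in : (i < n)%N by rewrite ltn_neqAle -ltnS ltn_ord andbT.
have := congr1 (fun m : 'X_{1..n} => m (Ordinal lt_in)) e1.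
by rewrite !mnmE (_ : widen_ord _ _ = i) //; apply: val_inj.
Qed.

(** A polynomial over a domain of characteristic 0 is determined by its values. *)
Lemma mpoly_vanish (K : idomainType) n (p : {mpoly K[n]}) :
  injective (fun n : nat => n%:R : K) -> (forall v, p.@[v] = 0) -> p = 0.
Proof.
move=> K0; elim: n p => [|n IHn] p p0.
  have := p0 (fun=> 0); rewrite mevalE => e.
  apply/mpolyP => m; rewrite mcoeff0.
  have m0 (m' : 'X_{1..0}) : m' = m by apply/mnmP => -[].
  have [m_p|] := boolP (m \in msupp p); last exact: memN_msupp_eq0.
  rewrite (bigD1_seq m) //= ?msupp_uniq // big_ord0 mulr1 big1 ?addr0 // in e.
  by move=> m' /eqP[].
apply: muni_eq0; apply: poly_vanish => [a b|t]; last first.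
  apply: IHn => v.
  pose w (i : 'I_n.+1) : K := if insub (val i) is Some j then v j else t%:R.
  apply: etrans _ (p0 w); rewrite muni_horner.
  rewrite -[w ord_max](_ : (t%:R : {mpoly K[n]}).@[v] = _) ?rmorph_nat; last first.
    by rewrite /w insubF //= ltnn.
  rewrite -horner_map /= rmorph_nat; congr (_.[_]).
  apply: eq_map_poly => q /=; apply: meval_eq => i.
  by rewrite /w /= insubT //= => lt_i; congr v; apply: val_inj.
move=> /(congr1 (mcoeff 0%MM)); rewrite -!mpolyC_nat !mcoeffC eqxx !mulr1.
exact: K0.
Qed.

(** * The minors of a pair of matrices *)

(** The determinant of the p x p matrix of the f a b with a, b < p, by expansion along the first
    row.  Unlike [\det] it reduces by computation. *)
Fixpoint laplace (A : comNzRingType) (p : nat) (f : nat -> nat -> A) : A :=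
  if p is p'.+1 then
    foldr +%R 0 [seq (-1) ^+ j * f 0%N j * laplace p' (fun a b => f a.+1 (if (b < j)%N then b else b.+1))
                | j <- iota 0 p]
  else 1.

Lemma det_laplace (A : comNzRingType) p (f : nat -> nat -> A) :
  \det (\matrix_(a < p, b < p) f a b) = laplace p f.
Proof.
elim: p f => [|p IHp] f; first by rewrite det_mx00.
rewrite (expand_det_row _ ord0) /laplace -/laplace foldrE big_map -[iota 0 _]/(index_iota 0 p.+1).
rewrite big_mkord; apply: eq_bigr => j _; rewrite /cofactor mxE add0n mulrCA mulrA -IHp.
congr (_ * \det _); apply/matrixP => a b; rewrite !mxE /= /bump.
by case: leqP.
Qed.

Lemma eq_laplace (A : comNzRingType) p (f g : nat -> nat -> A) :
  (forall a b, (a < p)%N -> (b < p)%N -> f a b = g a b) -> laplace p f = laplace p g.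
Proof.
move=> fg; rewrite -!det_laplace; congr (\det _); apply/matrixP => a b.
by rewrite !mxE fg.
Qed.

(** The minor Delta_i(js) of [x | y], for matrices given by their entries.  Rows and columns of
    x and y are numbered from 0, the elements of js from 1. *)
Definition minor (A : comNzRingType) (x y : nat -> nat -> A) (i : nat) (js : seq nat) : A :=
  laplace (i + size js) (fun a b => if (b < i)%N then x a b else y a (nth 0%N js (b - i)).-1).

Section GenValues.
Variables (A : comNzRingType) (x y : nat -> nat -> A).
Local Notation D i js := (minor x y i%N js%N).

(** The values of the twenty generators at (x, y): the generator g_j is at index j - 1. *)
Definition gen_values : seq A :=
  [:: D 0 [:: 1]; D 0 [:: 1; 2]; D 0 [:: 1; 2; 3]; D 0 [:: 1; 2; 3; 4];
      D 1 [::]; D 1 [:: 1]; D 1 [:: 1; 2]; D 1 [:: 1; 2; 3];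
      D 2 [::]; D 2 [:: 1]; D 2 [:: 1; 2];
      D 3 [::]; D 3 [:: 1]; D 4 [::];
      D 2 [:: 2] * D 0 [:: 1] - D 2 [:: 1] * D 0 [:: 2];
      D 2 [:: 2; 3] * D 0 [:: 1] - D 2 [:: 1; 3] * D 0 [:: 2]
        + D 2 [:: 1; 2] * D 0 [:: 3];
      D 2 [:: 1; 3] * D 0 [:: 1; 2] - D 2 [:: 1; 2] * D 0 [:: 1; 3];
      D 3 [:: 2] * D 0 [:: 1] - D 3 [:: 1] * D 0 [:: 2];
      D 3 [:: 3] * D 0 [:: 1; 2] - D 3 [:: 2] * D 0 [:: 1; 3]
        + D 3 [:: 1] * D 0 [:: 2; 3];
      D 3 [:: 2] * D 1 [:: 1] - D 3 [:: 1] * D 1 [:: 2]].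
End GenValues.

(** A ring morphism that sends the coordinates to the entries of x and y sends the minors of
    the generic pair to those of (x, y); applied to evaluations and to substitutions. *)
Lemma Delta_morph (F : fieldType) (A : comNzRingType)
    (psi : {rmorphism polyMM F 4 -> A}) (x y : nat -> nat -> A) :
  (forall a b, (a < 4)%N -> (b < 4)%N -> psi (xmx F 4 (inord a) (inord b)) = x a b) ->
  (forall a b, (a < 4)%N -> (b < 4)%N -> psi (ymx F 4 (inord a) (inord b)) = y a b) ->
  forall i js, (i + size js <= 4)%N -> all (fun j => (j <= 4)%N) js ->
  psi (@Delta F 3 i js) = minor x y i js.
Proof.
move=> hx hy i js le4 /allP js4; rewrite /Delta /minor -det_map_mx -det_laplace.
congr (\det _); apply/matrixP => a b; rewrite [LHS]mxE [X in psi X]mxE [RHS]mxE.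
have a4 := leq_trans (ltn_ord a) le4; have b4 := leq_trans (ltn_ord b) le4.
case: ifP => bi; first by rewrite row_mxEl; apply: (hx _ _ a4 b4).
have le_ib : (i <= b)%N by rewrite leqNgt bi.
rewrite row_mxEr; apply: (hy _ _ a4).
have /js4 : nth 0%N js (b - i) \in js by rewrite mem_nth // ltn_subLR.
by case: (nth _ _ _).
Qed.

Lemma gens_morph (F : fieldType) (A : comNzRingType)
    (psi : {rmorphism polyMM F 4 -> A}) (x y : nat -> nat -> A) :
  (forall a b, (a < 4)%N -> (b < 4)%N -> psi (xmx F 4 (inord a) (inord b)) = x a b) ->
  (forall a b, (a < 4)%N -> (b < 4)%N -> psi (ymx F 4 (inord a) (inord b)) = y a b) ->
  map psi (TA4_gens F) = gen_values x y.
Proof.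
(* From here on, only the values of psi at the minors matter. *)
move=> hx hy; have := Delta_morph hx hy.
rewrite /TA4_gens /gen_values.
move: (@Delta F 3) (minor x y) => D M DM.
by rewrite /= !(rmorphB, rmorphD, rmorphM, DM).
Qed.

Lemma sum_ord_lt (A : comNzRingType) (n p : nat) (f : nat -> A) :
  (p <= n)%N -> (forall c, (p <= c < n)%N -> f c = 0) ->
  \sum_(c < n) f c = \sum_(c < p) f c.
Proof.
move=> le_pn f0; rewrite -!(big_mkord predT) (big_cat_nat (n := p)) //=.
by rewrite [X in _ + X]big_nat [X in _ + X]big1 ?addr0.
Qed.

(** All the minors involve the first rows only, and are invariant under x -> u^T x, y -> u^T y
    for a unitriangular matrix u. *)
Lemma minor_row (A : comNzRingType) (u x y : nat -> nat -> A) i js :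
  (forall a b, (b <= a < 4)%N -> u a b = (a == b)%:R) ->
  (i + size js <= 4)%N ->
  minor (fun a b => \sum_(c < 4) u c a * x c b) (fun a b => \sum_(c < 4) u c a * y c b) i js
  = minor x y i js.
Proof.
move=> uU le4; rewrite /minor -!det_laplace; set p := (i + size js)%N in le4 *.
rewrite (_ : \matrix_(_, _) _ = (\matrix_(a < p, c < p) u c a) *m
   (\matrix_(a < p, b < p) if (b < i)%N then x a b else y a (nth 0%N js (b - i)).-1)).
  rewrite det_mulmx det_trig ?big1 ?mul1r // => [a _|].
    by rewrite mxE uU ?eqxx // leqnn (leq_trans (ltn_ord a)).
  apply/is_trig_mxP => a b lt_ab; rewrite mxE uU ?(ltnW lt_ab) ?(leq_trans (ltn_ord b)) //.
  by rewrite gtn_eqF.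
apply/matrixP => a b; rewrite !mxE.
under [RHS]eq_bigr => c _ do rewrite !mxE.
have u0 c : (p <= c < 4)%N -> u c a = 0.
  case/andP=> le_pc c4; have lt_ac := leq_trans (ltn_ord a) le_pc.
  by rewrite uU ?(ltnW lt_ac) // gtn_eqF.
case: ifP => _.
  by apply: (sum_ord_lt (f := fun c => u c a * x c b) le4) => c /u0 ->; rewrite mul0r.
set j := _.-1.
by apply: (sum_ord_lt (f := fun c => u c a * y c j) le4) => c /u0 ->; rewrite mul0r.
Qed.

(** The minors involve the first columns of x, so they are invariant under x -> x u. *)
Lemma minor_colx (A : comNzRingType) (u x y : nat -> nat -> A) i js :
  (forall a b, (b <= a < 4)%N -> u a b = (a == b)%:R) ->
  (i + size js <= 4)%N ->
  minor (fun a b => \sum_(c < 4) x a c * u c b) y i js = minor x y i js.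
Proof.
move=> uU le4; rewrite /minor -!det_laplace; set p := (i + size js)%N in le4 *.
pose W : 'M[A]_p := \matrix_(c < p, b < p) if (b < i)%N then u c b else (c == b)%:R.
have detW : \det W = 1.
  rewrite -det_tr det_trig ?big1 // => [a _|].
    rewrite !mxE; case: ifP; rewrite ?eqxx // => _.
    by rewrite uU ?eqxx // leqnn (leq_trans (ltn_ord a)).
  apply/is_trig_mxP => a b lt_ab; rewrite !mxE -val_eqE /= gtn_eqF //.
  by rewrite uU ?gtn_eqF ?if_same // (ltnW lt_ab) (leq_trans (ltn_ord b)).
rewrite -[RHS]mulr1 -detW -det_mulmx; congr (\det _).
apply/matrixP => a b; rewrite !mxE.
under [RHS]eq_bigr => c _ do rewrite !mxE.
case: ifP => b_i; last first.
  by rewrite (bigD1 b) //= b_i eqxx mulr1 big1 ?addr0 // => c /negPf->; rewrite mulr0.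
have u0 c : (p <= c < 4)%N -> u c b = 0.
  case/andP=> le_pc c4; have lt_bc := leq_trans (ltn_ord b) le_pc.
  by rewrite uU ?(ltnW lt_bc) // gtn_eqF.
rewrite (sum_ord_lt (f := fun c => x a c * u c b) le4); last by move=> c /u0 ->; rewrite mulr0.
(* Columns c >= i do not contribute to column b < i. *)
apply: eq_bigr => c _; case: ifP => // /negbT; rewrite -leqNgt => le_ic.
have lt_bc := leq_trans b_i le_ic.
by rewrite uU ?gtn_eqF ?mulr0 // (ltnW lt_bc) (leq_trans (ltn_ord c)).
Qed.

(** The minors Delta_i(1, ..., k) are invariant under y -> y u. *)
Lemma minor_coly (A : comNzRingType) (u x y : nat -> nat -> A) i k :
  (forall a b, (b <= a < 4)%N -> u a b = (a == b)%:R) ->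
  (i + k <= 4)%N ->
  minor x (fun a b => \sum_(c < 4) y a c * u c b) i (iota 1 k) = minor x y i (iota 1 k).
Proof.
move=> uU; rewrite /minor -!det_laplace size_iota; set p := (i + k)%N => le4.
have nthE b : (b < p)%N -> (b < i)%N = false -> (nth 0%N (iota 1 k) (b - i)).-1 = (b - i)%N.
  by move=> lt_bp /negbT; rewrite -leqNgt => ib; rewrite nth_iota // ltn_subLR.
have lt4 b : (b < p)%N -> (b - i < 4)%N.
  by move=> bp; apply: leq_ltn_trans (leq_subr _ _) (leq_trans bp le4).
pose W : 'M[A]_p := \matrix_(c < p, b < p)
  if (b < i)%N || (c < i)%N then (c == b)%:R else u (c - i)%N (b - i)%N.
have detW : \det W = 1.
  rewrite -det_tr det_trig ?big1 // => [a _|].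
    rewrite !mxE; case: ifP; rewrite ?eqxx // => _.
    by rewrite uU ?eqxx // leqnn lt4.
  apply/is_trig_mxP => a b lt_ab; rewrite !mxE -val_eqE /= gtn_eqF //.
  case: ifP => // /norP[a_i b_i]; rewrite uU ?leq_sub2r ?(ltnW lt_ab) ?lt4 //.
  by rewrite gtn_eqF // ltn_sub2rE // leqNgt.
rewrite -[RHS]mulr1 -detW -det_mulmx; congr (\det _).
apply/matrixP => a b; rewrite !mxE.
under [RHS]eq_bigr => c _ do rewrite !mxE.
case: ifP => b_i /=.
  by rewrite (bigD1 b) //= b_i eqxx mulr1 big1 ?addr0 // => c /negPf->; rewrite mulr0.
have le_ib : (i <= b)%N by rewrite leqNgt b_i.
rewrite nthE //.
have le_k4 : (k <= 4)%N by apply: leq_trans le4; rewrite leq_addl.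
have u0 c : (k <= c < 4)%N -> u c (b - i)%N = 0.
  case/andP=> kc c4; have lt_bc : (b - i < c)%N by apply: leq_trans kc; rewrite ltn_subLR.
  by rewrite uU ?gtn_eqF // (ltnW lt_bc).
rewrite (sum_ord_lt (f := fun c => y a c * u c (b - i)%N) le_k4); last first.
  by move=> c /u0 ->; rewrite mulr0.
pose g c : A := (if (c < i)%N then x a c else y a (nth 0%N (iota 1 k) (c - i)).-1) *
  (if (c < i)%N then (c == b)%:R else u (c - i)%N (b - i)%N).
rewrite -[RHS]/(\sum_(c < p) g c) -(big_mkord predT g) (big_cat_nat (n := i)) ?leq_addr //=.
rewrite [X in X + _]big_nat [X in X + _]big1 ?add0r; last first.
  by move=> c /= ci; rewrite /g ci ltn_eqF ?mulr0 // (leq_trans ci).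
rewrite -[X in index_iota X _]add0n big_addn addKn big_mkord; apply: eq_bigr => c _.
have ci : (c + i < i)%N = false by rewrite ltnNge leq_addl.
by rewrite /g ci nthE ?addnK // /p addnC ltn_add2l.
Qed.

(** The minors with columns 2, 3, (1, 3) and (2, 3) of y are not invariant under y -> y v;
    their combinations in the generators are. *)
Section ColumnsY.
Variables (A : comNzRingType) (v x y : nat -> nat -> A).
Hypothesis vU : forall a b, (b <= a < 4)%N -> v a b = (a == b)%:R.
Let y' a b := \sum_(c < 4) y a c * v c b.
Local Notation D' i js := (minor x y' i%N js%N).
Local Notation D i js := (minor x y i%N js%N).

Let v1 a : (a < 4)%N -> v a a = 1.
Proof. by move=> a4; rewrite vU ?eqxx // leqnn. Qed.
Let v0 a b : (b < a < 4)%N -> v a b = 0.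
Proof. by case/andP=> ba a4; rewrite vU ?gtn_eqF // ltnW. Qed.
Let y'0 a : y' a 0%N = y a 0%N.
Proof. by rewrite /y' !big_ord_recr big_ord0 /= v1 // (@v0 1) // (@v0 2) // (@v0 3) //; ring. Qed.
Let y'1 a : y' a 1%N = y a 1%N + v 0%N 1%N * y a 0%N.
Proof. by rewrite /y' !big_ord_recr big_ord0 /= v1 // (@v0 2) // (@v0 3) //; ring. Qed.
Let y'2 a : y' a 2%N = y a 2%N + v 1%N 2%N * y a 1%N + v 0%N 2%N * y a 0%N.
Proof. by rewrite /y' !big_ord_recr big_ord0 /= v1 // (@v0 3) //; ring. Qed.

Lemma minor_coly2 i : (i < 4)%N -> D' i [:: 2] = D i [:: 2] + v 0%N 1%N * D i [:: 1].
Proof.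
case: i => [|[|[|[|//]]]] _; rewrite /minor /= ?(y'0, y'1, y'2); ring.
Qed.

Lemma minor_coly3 i : (i < 4)%N ->
  D' i [:: 3] = D i [:: 3] + v 1%N 2%N * D i [:: 2] + v 0%N 2%N * D i [:: 1].
Proof.
case: i => [|[|[|[|//]]]] _; rewrite /minor /= ?(y'0, y'1, y'2); ring.
Qed.

Lemma minor_coly13 i : (i < 3)%N ->
  D' i [:: 1; 3] = D i [:: 1; 3] + v 1%N 2%N * D i [:: 1; 2].
Proof.
case: i => [|[|[|//]]] _; rewrite /minor /= ?(y'0, y'1, y'2); ring.
Qed.

Lemma minor_coly23 i : (i < 3)%N ->
  D' i [:: 2; 3] = D i [:: 2; 3] + v 0%N 1%N * D i [:: 1; 3]
    + (v 0%N 1%N * v 1%N 2%N - v 0%N 2%N) * D i [:: 1; 2].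
Proof.
case: i => [|[|[|//]]] _; rewrite /minor /= ?(y'0, y'1, y'2); ring.
Qed.

Lemma gen_values_coly : gen_values x y' = gen_values x y.
Proof.
rewrite /gen_values ?(minor_coly2, minor_coly3, minor_coly13, minor_coly23) //.
have E i k : (i + k <= 4)%N -> D' i (iota 1 k) = D i (iota 1 k) by exact: minor_coly.
rewrite (E 0 1)%N // (E 0 2)%N // (E 0 3)%N // (E 0 4)%N // (E 1 0)%N // (E 1 1)%N //.
rewrite (E 1 2)%N // (E 1 3)%N // (E 2 0)%N // (E 2 1)%N // (E 2 2)%N // (E 3 0)%N //.
rewrite (E 3 1)%N // (E 4 0)%N //.
move: (minor x y) => M /=.
by do 14 (congr cons); congr [:: _; _; _; _; _; _]; ring.
Qed.

End ColumnsY.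

Lemma gen_values_colx (A : comNzRingType) (u x y : nat -> nat -> A) :
  (forall a b, (b <= a < 4)%N -> u a b = (a == b)%:R) ->
  gen_values (fun a b => \sum_(c < 4) x a c * u c b) y = gen_values x y.
Proof.
move=> uU; have := fun i js => @minor_colx A u x y i js uU.
by rewrite /gen_values; move: (minor _ y) (minor x y) => M' M E; rewrite !E.
Qed.

Lemma gen_values_row (A : comNzRingType) (u x y : nat -> nat -> A) :
  (forall a b, (b <= a < 4)%N -> u a b = (a == b)%:R) ->
  gen_values (fun a b => \sum_(c < 4) u c a * x c b) (fun a b => \sum_(c < 4) u c a * y c b)
  = gen_values x y.
Proof.
move=> uU; have := fun i js => @minor_row A u x y i js uU.
by rewrite /gen_values; move: (minor _ _) (minor x y) => M' M E; rewrite !E.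
Qed.

(** * Invariance under unitriangular matrices, and the slice *)

(** The entries of a 4 x 4 matrix as a function of two natural numbers less than 4. *)
Definition entry (A : nzRingType) (m : 'M[A]_4) (a b : nat) : A := m (inord a) (inord b).

Lemma entry_mul (A : nzRingType) (m u : 'M[A]_4) a b :
  entry (m *m u) a b = \sum_(c < 4) entry m a c * entry u c b.
Proof. by rewrite /entry mxE; apply: eq_bigr => c _; rewrite inord_val. Qed.

Lemma entry_trmul (A : nzRingType) (u m : 'M[A]_4) a b :
  entry (u^T *m m) a b = \sum_(c < 4) entry u c a * entry m c b.
Proof. by rewrite /entry mxE; apply: eq_bigr => c _; rewrite mxE inord_val. Qed.

Lemma entry_unitriangular (F : fieldType) (u : 'M[F]_4) : unitriangular u ->
  forall a b, (b <= a < 4)%N -> entry u a b = (a == b)%:R.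
Proof.
move=> uU a b /andP[ba a4]; have b4 := leq_ltn_trans ba a4.
by rewrite /entry uU -?val_eqE /= !inordK.
Qed.

Lemma eq_minor (A : comNzRingType) (x x' y y' : nat -> nat -> A) i js :
  (forall a b, x a b = x' a b) -> (forall a b, y a b = y' a b) ->
  minor x y i js = minor x' y' i js.
Proof. by move=> hx hy; apply: eq_laplace => a b _ _; case: ifP. Qed.

Lemma eq_gen_values (A : comNzRingType) (x x' y y' : nat -> nat -> A) :
  (forall a b, x a b = x' a b) -> (forall a b, y a b = y' a b) ->
  gen_values x y = gen_values x' y'.
Proof.
move=> hx hy; have := fun i js => @eq_minor A x x' y y' i js hx hy.
by rewrite /gen_values; move: (minor _ _) (minor x' y') => M' M E; rewrite !E.
Qed.

Lemma gen_values_act (F : fieldType) (u1 u2 u3 m1 m2 : 'M[F]_4) :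
  unitriangular u1 -> unitriangular u2 -> unitriangular u3 ->
  gen_values (entry (u1^T *m m1 *m u2)) (entry (u1^T *m m2 *m u3)) = gen_values (entry m1) (entry m2).
Proof.
move=> U1 U2 U3; rewrite (eq_gen_values (entry_mul _ _) (entry_mul _ _)).
rewrite gen_values_colx ?gen_values_coly; try exact: entry_unitriangular.
by rewrite (eq_gen_values (entry_trmul _ _) (entry_trmul _ _)) gen_values_row //; apply: entry_unitriangular.
Qed.

Lemma gens_meval (F : fieldType) (m1 m2 : 'M[F]_4) :
  map (meval (coords m1 m2)) (TA4_gens F) = gen_values (entry m1) (entry m2).
Proof.
apply: gens_morph => a b _ _.
  by have /matrixP/(_ (inord a) (inord b)) := meval_xmx m1 m2; rewrite mxE.
by have /matrixP/(_ (inord a) (inord b)) := meval_ymx m1 m2; rewrite mxE.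
Qed.

Lemma tnth_gens_meval (F : fieldType) (m1 m2 : 'M[F]_4) (j : 'I_20) :
  (tnth (TA4_gens F) j).@[coords m1 m2] = (gen_values (entry m1) (entry m2))`_j.
Proof.
rewrite -gens_meval (nth_map 0) ?size_tuple //; congr (_.@[_]).
by rewrite (tnth_nth 0).
Qed.

Lemma coords_vec (F : fieldType) n (v : 'I_(n * n + n * n) -> F) :
  exists m1 m2 : 'M[F]_n, coords m1 m2 =1 v.
Proof.
pose r := \row_k v k.
exists (vec_mx (lsubmx r)), (vec_mx (rsubmx r)) => k.
by rewrite /coords !vec_mxK hsubmxK mxE.
Qed.

Section Char0.
Variable F : fieldType.
Hypothesis F0 : injective (fun n : nat => n%:R : F).

(** Invariance can be tested at points. *)
Lemma TAP (n : nat) (f : polyMM F n) :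
  TA f <-> forall u1 u2 u3 m1 m2 : 'M[F]_n,
    unitriangular u1 -> unitriangular u2 -> unitriangular u3 ->
    f.@[coords (u1^T *m m1 *m u2) (u1^T *m m2 *m u3)] = f.@[coords m1 m2].
Proof.
split=> [fTA u1 u2 u3 m1 m2 U1 U2 U3|h u1 u2 u3 U1 U2 U3].
  by rewrite -meval_act fTA.
apply/eqP; rewrite -subr_eq0; apply/eqP/(mpoly_vanish F0) => v.
have [m1 [m2 /meval_eq <-]] := coords_vec v.
by rewrite mevalB meval_act h // subrr.
Qed.

Lemma subalgebra_TA (P : {mpoly F[20]}) : TA (P \mPo TA4_gens F).
Proof.
apply/TAP => u1 u2 u3 m1 m2 U1 U2 U3; rewrite !comp_mpoly_meval.
by apply: meval_eq => j; rewrite !tnth_gens_meval gen_values_act.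
Qed.
End Char0.

(** If the leading minors of x of order less than n are nonzero, column operations by a
    unitriangular matrix u make x lower triangular: column b of u solves a linear system
    whose matrix is the leading submatrix of order b. *)
Lemma clear_row (F : fieldType) (x : nat -> nat -> F) n :
  (forall k, (k < n)%N -> laplace k x != 0) ->
  exists u : nat -> nat -> F, (forall a b, (b <= a)%N -> u a b = (a == b)%:R) /\
    forall a b, (a < b < n)%N -> \sum_(c < n) x a c * u c b = 0.
Proof.
move=> x0; pose M b : 'M[F]_b := \matrix_(a < b, c < b) x a c.
pose w b := invmx (M b) *m (\col_a x a b).
pose u a b := if insub a is Some i then - w b i 0 else (a == b)%:R.
have uE a b : (b <= a)%N -> u a b = (a == b)%:R by move=> ba; rewrite /u insubF // ltnNge ba.
exists u; split=> // a b /andP[ab bn].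
have Mw : M b *m w b = \col_a x a b.
  by rewrite mulmxA mulmxV ?mul1mx // unitmxE det_laplace unitfE x0.
rewrite (sum_ord_lt (f := fun c => x a c * u c b) bn); last first.
  by move=> c /andP[bc _]; rewrite uE ?gtn_eqF ?mulr0 // ltnW.
rewrite big_ord_recr /= uE // eqxx mulr1.
have := congr1 (fun m : 'cV_b => m (Ordinal ab) 0) Mw; rewrite mxE [RHS]mxE /= => <-.
rewrite -big_split big1 //= => c _; rewrite [M b _ _]mxE /u valK.
by rewrite mulrN addNr.
Qed.

Section Slice.
Variable F : fieldType.
Implicit Types m u : 'M[F]_4.

Lemma clear_mx m : (forall k, (k < 4)%N -> laplace k (entry m) != 0) ->
  exists2 u, unitriangular u & forall i j : 'I_4, (i < j)%N -> (m *m u) i j = 0.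
Proof.
case/clear_row => u [uU um]; exists (\matrix_(i, j) u i j).
  by move=> i j ij; rewrite mxE uU // val_eqE.
move=> i j ij; rewrite -[RHS](um i j) ?ij ?ltn_ord // mxE; apply: eq_bigr => c _.
by rewrite !mxE /entry !inord_val.
Qed.

(** The leading minors of x and y of order at most 3 are 1 and the values of the pivots. *)
Lemma laplace_gen_values (x y : nat -> nat -> F) k : (k < 4)%N ->
  laplace k x = (1 :: gen_values x y)`_(nth 0 [:: 0; 5; 9; 12] k)%N /\
  laplace k y = (1 :: gen_values x y)`_k.
Proof.
by case: k => [|[|[|[|//]]]] _; split.
Qed.

(** The indices of the pivots g_1, g_2, g_3, g_5, g_9 and g_12 in the tuple of generators. *)
Definition pivots := [:: 0; 1; 2; 4; 8; 11]%N.

(** Elimination: x is made lower triangular by u2, then diagonal by u1, and finally y is made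
    lower triangular by u3.  The pivots, being invariant, stay nonzero all along. *)
Lemma to_slice m1 m2 : all (fun i => (gen_values (entry m1) (entry m2))`_i != 0) pivots ->
  exists u1 u2 u3, [/\ unitriangular u1, unitriangular u2 & unitriangular u3] /\
    (forall i j : 'I_4, i != j -> (u1^T *m m1 *m u2) i j = 0) /\
    (forall i j : 'I_4, (i < j)%N -> (u1^T *m m2 *m u3) i j = 0).
Proof.
set G := gen_values _ _ => piv.
have Id : unitriangular (1%:M : 'M[F]_4) by move=> i j _; rewrite mxE.
have leadx m m' : gen_values (entry m) (entry m') = G ->
    forall k, (k < 4)%N -> laplace k (entry m) != 0.
  move=> e k k4; have [-> _] := laplace_gen_values (entry m) (entry m') k4; rewrite e.
  by case/and5P: piv => ? ? ? ? /and3P[? ? _]; case: k k4 => [|[|[|[|//]]]] _; rewrite ?oner_eq0.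
have leady m m' : gen_values (entry m) (entry m') = G ->
    forall k, (k < 4)%N -> laplace k (entry m') != 0.
  move=> e k k4; have [_ ->] := laplace_gen_values (entry m) (entry m') k4; rewrite e.
  by case/and5P: piv => ? ? ? ? /and3P[? ? _]; case: k k4 => [|[|[|[|//]]]] _; rewrite ?oner_eq0.
have [u2 U2 low] := clear_mx (leadx m1 m2 erefl).
have lapT k : (k < 4)%N -> laplace k (entry (m1 *m u2)^T) != 0.
  have e : gen_values (entry (m1 *m u2)) (entry m2) = G.
    by rewrite -[RHS](gen_values_act m1 m2 Id U2 Id) trmx1 !mul1mx mulmx1.
  move/(leadx _ _ e); rewrite -!det_laplace -det_tr; congr (\det _ != 0).
  by apply/matrixP => a b; rewrite !mxE /entry !mxE.
have [u1 U1 diag] := clear_mx lapT.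
have [|u3 U3 low3] := @clear_mx (u1^T *m m2).
  apply: (leady (u1^T *m m1)).
  by rewrite -[RHS](gen_values_act m1 m2 U1 Id Id) !mulmx1.
exists u1, u2, u3; split=> //; split=> // i j.
rewrite -mulmxA neq_ltn => /orP[ij|ji].
  rewrite mxE big1 // => c _; rewrite mxE.
  have [ci|ic] := leqP c i; first by rewrite low ?mulr0 // (leq_ltn_trans ci).
  by rewrite U1 ?(ltnW ic) // -val_eqE gtn_eqF // mul0r.
by rewrite -[u1^T *m _]trmxK mxE trmx_mul trmxK diag.
Qed.
End Slice.

(** * The generators on the slice, and the exchange relations *)

Section SliceValues.
Variables (A : comNzRingType).

(** The values of the generators when x = diag(a, b, c, d) and y is the lower triangular matrix
    with rows (e), (q, l), (r, s, u), (v, w, z, k). *)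
Definition slice_values (x y : nat -> nat -> A) : seq A :=
  let: (a, b, c, d) := (x 0%N 0%N, x 1%N 1%N, x 2%N 2%N, x 3%N 3%N) in
  let: (e, l, u, k) := (y 0%N 0%N, y 1%N 1%N, y 2%N 2%N, y 3%N 3%N) in
  let: (q, r, v) := (y 1%N 0%N, y 2%N 0%N, y 3%N 0%N) in
  let: (s, w, z) := (y 2%N 1%N, y 3%N 1%N, y 3%N 2%N) in
  [:: e; e * l; e * l * u; e * l * u * k;
      a; a * q; a * (q * s - l * r); a * (q * (s * z - u * w) - l * (r * z - u * v));
      a * b; a * b * r; a * b * (r * w - s * v);
      a * b * c; a * b * c * v; a * b * c * d;
      a * b * e * s; a * b * e * (s * z - u * w); a * b * e * l * (r * z - u * v);
      a * b * c * e * w; a * b * c * e * l * z; a * a * b * c * (q * w - l * v)].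

Lemma gen_values_slice (x y : nat -> nat -> A) :
  (forall i j, (i < 4)%N -> (j < 4)%N -> i != j -> x i j = 0) ->
  (forall i j, (i < j < 4)%N -> y i j = 0) ->
  gen_values x y = slice_values x y.
Proof.
move=> x0 y0; rewrite /gen_values /slice_values /minor /=.
rewrite ?(x0 0 1)%N ?(x0 0 2)%N ?(x0 0 3)%N ?(x0 1 0)%N ?(x0 1 2)%N ?(x0 1 3)%N //.
rewrite ?(x0 2 0)%N ?(x0 2 1)%N ?(x0 2 3)%N ?(x0 3 0)%N ?(x0 3 1)%N ?(x0 3 2)%N //.
rewrite ?(y0 0 1)%N ?(y0 0 2)%N ?(y0 0 3)%N ?(y0 1 2)%N ?(y0 1 3)%N ?(y0 2 3)%N //.
by do 14 (congr cons; first by ring); congr [:: _; _; _; _; _; _]; ring.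
Qed.
End SliceValues.

(** The monomial in n + 1 variables with a list of variables, numbered from 0. *)
Definition mon (R : nzRingType) (n : nat) (s : seq nat) : {mpoly R[n.+1]} :=
  \prod_(i <- s) 'X_(inord i).

Lemma mon_meval (R : comNzRingType) n (v : 'I_n.+1 -> R) s :
  (mon R n s).@[v] = \prod_(i <- s) v (inord i).
Proof. by rewrite /mon rmorph_prod; apply: eq_bigr => i _; rewrite /= mevalXU. Qed.

(** The exchange relation ((a, b), (M1, M2)) stands for X_a X_b = M1 + M2, the monomials M1 and
    M2 being given by lists of variables; variables are numbered from 1, like the generators. *)
Definition exchange : Type := ((nat * nat) * (seq nat * seq nat))%type.

Definition exchanges : seq exchange :=
  [:: ((6, 15), ([:: 1; 7; 9], [:: 2; 5; 10]));
      ((6, 16), ([:: 1; 8; 9], [:: 5; 17]));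
      ((10, 18), ([:: 1; 11; 12], [:: 13; 15]));
      ((10, 20), ([:: 6; 11; 12], [:: 7; 9; 13]));
      ((7, 17), ([:: 2; 8; 10], [:: 3; 6; 11]));
      ((7, 19), ([:: 2; 8; 12], [:: 3; 20]));
      ((6, 18), ([:: 1; 20], [:: 2; 5; 13]));
      ((7, 16), ([:: 8; 15], [:: 3; 5; 11]));
      ((10, 19), ([:: 12; 17], [:: 3; 9; 13]));
      ((15, 17), ([:: 2; 10; 16], [:: 1; 3; 9; 11]));
      ((15, 19), ([:: 2; 12; 16], [:: 3; 9; 18]));
      ((15, 20), ([:: 7; 9; 18], [:: 2; 5; 11; 12]));
      ((16, 20), ([:: 5; 11; 19], [:: 8; 9; 18]));
      ((17, 20), ([:: 6; 11; 19], [:: 2; 8; 9; 13]));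
      ((17, 18), ([:: 1; 11; 19], [:: 2; 13; 16]))]%N.

(** The monomial with a list of variables numbered from 1. *)
Definition mon1 (R : nzRingType) n s := mon R n (map predn s).

Definition exchange_poly (R : nzRingType) (t : exchange) :
    {mpoly R[20]} :=
  mon1 R 19 [:: t.1.1; t.1.2] - mon1 R 19 t.2.1 - mon1 R 19 t.2.2.

(** The given relations are the exchange relations, the first six up to sign. *)
Lemma rels_exchange (F : fieldType) :
  TA4_rels F = [seq - exchange_poly F t | t <- take 6 exchanges]
            ++ [seq exchange_poly F t | t <- drop 6 exchanges] :> seq _.
Proof.
rewrite /TA4_rels /exchange_poly /mon1 /mon /=.
do 14 (congr cons; first by rewrite !(big_cons, big_nil) /=; ring).
congr [:: _]; rewrite !(big_cons, big_nil); ring.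
Qed.

(** The product of the values, in the list G, of generators numbered from 1. *)
Definition value_prod (A : comNzRingType) (G : seq A) (s : seq nat) := \prod_(i <- s) G`_(i.-1).

Lemma slice_exchanges (A : comNzRingType) (x y : nat -> nat -> A) :
  [seq value_prod (slice_values x y) [:: t.1.1; t.1.2] | t <- exchanges] =
  [seq value_prod (slice_values x y) t.2.1 + value_prod (slice_values x y) t.2.2 | t <- exchanges].
Proof.
rewrite /value_prod /= !(big_cons, big_nil) /=.
do 14 (congr cons; first by ring).
by congr [:: _]; ring.
Qed.

Lemma mon1_meval (A : comNzRingType) (v : 'I_20 -> A) (G : seq A) (s : seq nat) :
  (forall j, v j = G`_j) -> all (fun i => (0 < i <= 20)%N) s ->
  (mon1 A 19 s).@[v] = value_prod G s.
Proof.
move=> vG /allP s20; rewrite /mon1 mon_meval /value_prod big_map [LHS]big_seq [RHS]big_seq.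
by apply: eq_bigr => i /s20/andP[i0 i20]; rewrite vG inordK // prednK.
Qed.

Lemma exchanges_bound t : t \in exchanges ->
  [/\ all (fun i => (0 < i <= 20)%N) [:: t.1.1; t.1.2],
      all (fun i => (0 < i <= 20)%N) t.2.1 & all (fun i => (0 < i <= 20)%N) t.2.2].
Proof.
have /allP h : all (fun t : exchange =>
   [&& all (fun i => (0 < i <= 20)%N) [:: t.1.1; t.1.2],
      all (fun i => (0 < i <= 20)%N) t.2.1 & all (fun i => (0 < i <= 20)%N) t.2.2])
   exchanges by [].
by move=> /h/and3P.
Qed.

Lemma exchange_meval (A : comNzRingType) (v : 'I_20 -> A) (x y : nat -> nat -> A) t :
  t \in exchanges -> (forall j, v j = (slice_values x y)`_j) ->
  (exchange_poly A t).@[v] = 0.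
Proof.
move=> tin vG; have [b1 b2 b3] := exchanges_bound tin.
rewrite /exchange_poly !mevalB !(mon1_meval vG) // -addrA -opprD.
have := slice_exchanges x y; move: (slice_values x y) => G /eq_in_map -> //.
by rewrite subrr.
Qed.

(** If the coordinates s_i are the values at v of the fractions N_i / H, then the value of f at s,
    times a power of the value of H at v, is the value at v of a polynomial.  Division is avoided,
    so that H may vanish at v. *)
Lemma homogenize (K : comNzRingType) k l (f : {mpoly K[k]}) (N : 'I_k -> {mpoly K[l]})
    (H : {mpoly K[l]}) :
  exists D Q, forall v s, (forall i, H.@[v] * s i = (N i).@[v]) ->
    H.@[v] ^+ D * f.@[s] = Q.@[v].
Proof.
exists (msize f), (\sum_(m <- msupp f) f@_m *:
   (H ^+ (msize f - mdeg m) * \prod_i N i ^+ m i)) => v s Hs.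
rewrite mevalE raddf_sum /= mulr_sumr [LHS]big_seq [RHS]big_seq.
apply: eq_bigr => m m_f; rewrite mevalZ mulrCA; congr (_ * _).
rewrite mevalM rmorphXn rmorph_prod /= -{1}(subnK (ltnW (msize_mdeg_lt m_f))) exprD -mulrA.
congr (_ * _); rewrite mdegE -prodrXr -big_split /=.
by apply: eq_bigr => i _; rewrite rmorphXn /= -Hs exprMn.
Qed.

Section Localization.
Variable F : fieldType.
Hypothesis F0 : injective (fun n : nat => n%:R : F).

(** Numerators of the entries of the point of the slice equivalent to (x, y), over the product
    of the six pivots: for instance, the entry (2, 1) of y is g_6 / g_5, so it has numerator
    g_6 g_1 g_2 g_3 g_9 g_12. *)
Definition slice_x : 'M[{mpoly F[20]}]_4 := \matrix_(i, j)
  if i == j then mon1 F 19 (nth [::] [:: [:: 5; 1; 2; 3; 5; 9; 12]; [:: 9; 1; 2; 3; 9; 12];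
     [:: 12; 1; 2; 3; 5; 12]; [:: 14; 1; 2; 3; 5; 9]]%N i) else 0.
Definition slice_y : 'M[{mpoly F[20]}]_4 := \matrix_(i, j)
  if (j <= i)%N then mon1 F 19 (nth [::] (nth [::]
   [:: [:: [:: 1; 1; 2; 3; 5; 9; 12]];
       [:: [:: 6; 1; 2; 3; 9; 12]; [:: 2; 2; 3; 5; 9; 12]];
       [:: [:: 10; 1; 2; 3; 5; 12]; [:: 15; 2; 3; 5; 12]; [:: 3; 1; 3; 5; 9; 12]];
       [:: [:: 13; 1; 2; 3; 5; 9]; [:: 18; 2; 3; 5; 9]; [:: 19; 1; 3; 5; 9]; [:: 4; 1; 2; 5; 9; 12]]]%N
   i) j) else 0.

Definition pivot_prod : {mpoly F[20]} := mon1 F 19 [:: 1; 2; 3; 5; 9; 12]%N.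

Lemma slice_coords (x y : 'M[F]_4) (v : 'I_20 -> F) :
  (forall i j : 'I_4, i != j -> x i j = 0) ->
  (forall i j : 'I_4, (i < j)%N -> y i j = 0) ->
  (forall j, v j = (slice_values (entry x) (entry y))`_j) ->
  forall k, pivot_prod.@[v] * coords x y k = (coords slice_x slice_y k).@[v].
Proof.
move=> x0 y0 vG k; have Pv := mon1_meval vG (s := [:: 1; 2; 3; 5; 9; 12]%N) isT.
have ex (i j : 'I_4) : x i j = entry x i j by rewrite /entry !inord_val.
have ey (i j : 'I_4) : y i j = entry y i j by rewrite /entry !inord_val.
rewrite /pivot_prod {}Pv /coords !mxE; case: splitP => k' _; case/mxvec_indexP: k' => i j.
  rewrite !mxvecE [slice_x _ _]mxE; case: eqP => [<-|/eqP ij]; last by rewrite x0 // mulr0 meval0.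
  rewrite ex (mon1_meval vG); last by move: i => [[|[|[|[|//]]]]].
  move: i => [[|[|[|[|//]]]]] ? /=; rewrite /value_prod !(big_cons, big_nil) /=; ring.
rewrite !mxvecE [slice_y _ _]mxE; case: leqP => [ji|ij]; last by rewrite y0 // mulr0 meval0.
rewrite ey (mon1_meval vG); last by move: i j ji => [[|[|[|[|//]]]]] ? [[|[|[|[|//]]]]].
move: i j ji => [[|[|[|[|//]]]]] ? [[|[|[|[|//]]]]] ? //= _;
  rewrite /value_prod !(big_cons, big_nil) /=; ring.
Qed.

Lemma entry_diag (A : nzRingType) (x : 'M[A]_4) : (forall i j : 'I_4, i != j -> x i j = 0) ->
  forall i j, (i < 4)%N -> (j < 4)%N -> i != j -> entry x i j = 0.
Proof. by move=> x0 i j i4 j4 ij; rewrite /entry x0 // -val_eqE /= !inordK. Qed.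

Lemma entry_low (A : nzRingType) (y : 'M[A]_4) : (forall i j : 'I_4, (i < j)%N -> y i j = 0) ->
  forall i j, (i < j < 4)%N -> entry y i j = 0.
Proof. by move=> y0 i j /andP[ij j4]; rewrite /entry y0 // !inordK // (ltn_trans ij). Qed.

Lemma pivot_prodE (m1 m2 : 'M[F]_4) :
  (pivot_prod \mPo TA4_gens F).@[coords m1 m2] =
  value_prod (gen_values (entry m1) (entry m2)) [:: 1; 2; 3; 5; 9; 12]%N.
Proof.
rewrite comp_mpoly_meval /pivot_prod (mon1_meval (G := gen_values (entry m1) (entry m2))) //.
by move=> j; rewrite tnth_gens_meval.
Qed.

Lemma pivot_prod_neq0 : pivot_prod \mPo TA4_gens F != 0.
Proof.
apply/eqP => /(congr1 (meval (coords (1%:M : 'M[F]_4) 1%:M))).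
have e (i j : 'I_4) : i != j -> (1%:M : 'M[F]_4) i j = 0 by move=> /negPf ij; rewrite mxE ij.
have d i : (i < 4)%N -> entry (1%:M : 'M[F]_4) i i = 1.
  by move=> i4; rewrite /entry mxE eqxx.
rewrite meval0 pivot_prodE gen_values_slice; first last.
- by apply: entry_low => i j ij; rewrite e // neq_ltn ij.
- exact: entry_diag.
rewrite /value_prod !(big_cons, big_nil) /= !d // !mulr1 => /eqP.
by rewrite oner_eq0.
Qed.

Lemma pivot_prod_neq0_at (m1 m2 : 'M[F]_4) :
  (pivot_prod \mPo TA4_gens F).@[coords m1 m2] != 0 ->
  all (fun i => (gen_values (entry m1) (entry m2))`_i != 0) pivots.
Proof.
rewrite pivot_prodE /value_prod !(big_cons, big_nil) /pivots /= mulr1 !mulf_eq0 !negb_or.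
by case/and5P => -> -> -> -> /andP[-> ->].
Qed.

(** An invariant that vanishes on the slice is 0, because the orbit of the slice contains all
    points where the pivots do not vanish. *)
Lemma TA_eq0_on_slice (f : polyMM F 4) : TA f ->
  (forall x y : 'M[F]_4, (forall i j : 'I_4, i != j -> x i j = 0) ->
     (forall i j : 'I_4, (i < j)%N -> y i j = 0) -> f.@[coords x y] = 0) ->
  f = 0.
Proof.
move=> /(TAP F0) fTA f0; apply/eqP.
suff: (pivot_prod \mPo TA4_gens F) * f == 0.
  by rewrite mulf_eq0 (negPf pivot_prod_neq0).
apply/eqP/(mpoly_vanish F0) => v; have [m1 [m2 /meval_eq <-]] := coords_vec v.
rewrite mevalM; apply/eqP; rewrite mulf_eq0 -implyNb; apply/implyP.
move=> /pivot_prod_neq0_at/to_slice[u1 [u2 [u3 [[U1 U2 U3] [dx ly]]]]].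
by rewrite -(fTA u1 u2 u3) // f0.
Qed.

(** The relations hold: their values are invariants, and vanish on the slice. *)
Lemma exchange_gens t : t \in exchanges -> exchange_poly F t \mPo TA4_gens F = 0.
Proof.
move=> tin; apply: TA_eq0_on_slice => [|x y x0 y0]; first exact: subalgebra_TA.
rewrite comp_mpoly_meval; apply: (exchange_meval (x := entry x) (y := entry y)) => // j.
by rewrite tnth_gens_meval gen_values_slice //; [apply: entry_diag | apply: entry_low].
Qed.

(** Every invariant lies in the subalgebra of the generators, once multiplied by a power of
    the product of the pivots. *)
Lemma TA_localized (f : polyMM F 4) : TA f ->
  exists D, subalgebra_gen (TA4_gens F) ((pivot_prod \mPo TA4_gens F) ^+ D * f).
Proof.
move=> /(TAP F0) fTA; set h := _ \mPo _.
have [D [Q DQ]] := homogenize f (coords slice_x slice_y) pivot_prod.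
exists D, Q; apply/eqP; rewrite -subr_eq0.
suff: h * (h ^+ D * f - (Q \mPo TA4_gens F)) == 0.
  by rewrite mulf_eq0 (negPf pivot_prod_neq0).
apply/eqP/(mpoly_vanish F0) => v; have [m1 [m2 /meval_eq <-]] := coords_vec v.
rewrite mevalM; apply/eqP; rewrite mulf_eq0 -implyNb; apply/implyP.
move=> /pivot_prod_neq0_at/to_slice[u1 [u2 [u3 [[U1 U2 U3] [dx ly]]]]].
rewrite mevalB subr_eq0 mevalM rmorphXn /= !comp_mpoly_meval -(fTA u1 u2 u3) //.
apply/eqP/DQ => k; apply: slice_coords => // j.
by rewrite tnth_gens_meval -(gen_values_act m1 m2 U1 U2 U3) gen_values_slice //;
  [apply: entry_diag | apply: entry_low].
Qed.
End Localization.

(** * Straightening modulo the relations *)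

Section Ideal.
Variables (F : fieldType) (m l : nat) (r : l.-tuple {mpoly F[m]}).
Implicit Types P Q : {mpoly F[m]}.

Lemma ideal_gen0 : ideal_gen r 0.
Proof. by exists (fun=> 0); rewrite big1 // => j _; rewrite mul0r. Qed.

Lemma ideal_genD P Q : ideal_gen r P -> ideal_gen r Q -> ideal_gen r (P + Q).
Proof.
move=> [c ->] [d ->]; exists (fun j => c j + d j).
by rewrite -big_split; apply: eq_bigr => j _; rewrite mulrDl.
Qed.

Lemma ideal_genM P Q : ideal_gen r P -> ideal_gen r (Q * P).
Proof.
move=> [c ->]; exists (fun j => Q * c j).
by rewrite mulr_sumr; apply: eq_bigr => j _; rewrite mulrA.
Qed.

Lemma ideal_gen_mem P : P \in (r : seq _) -> ideal_gen r P.
Proof.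
case/tnthP => i ->; exists (fun j => (j == i)%:R).
by rewrite (bigD1 i) //= eqxx mul1r big1 ?addr0 // => j /negPf->; rewrite mul0r.
Qed.
End Ideal.

Section Standard.
Variable F : fieldType.

Lemma ideal_gen_exchange t : t \in exchanges -> ideal_gen (TA4_rels F) (exchange_poly F t).
Proof.
rewrite -{1}(cat_take_drop 6 exchanges) mem_cat => /orP[] tin; last first.
  by apply: ideal_gen_mem; rewrite rels_exchange mem_cat map_f ?orbT.
rewrite -[exchange_poly _ _]opprK -mulN1r; apply/ideal_genM/ideal_gen_mem.
rewrite rels_exchange mem_cat; apply/orP; left.
exact: (map_f (fun t => - exchange_poly F t)).
Qed.

(** The exponent of the monomial with a list of variables, numbered from 0 in [expt] and from 1
    in [expt1]. *)
Definition expt (n : nat) (s : seq nat) : 'X_{1..n.+1} := (\sum_(i <- s) U_(inord i))%MM.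
Definition expt1 n s := expt n (map predn s).

Lemma monE (R : comNzRingType) n s : mon R n s = 'X_[expt n s].
Proof.
rewrite /mon /expt; elim: s => [|i s IHs]; first by rewrite !big_nil mpolyX0.
by rewrite !big_cons IHs mpolyXD.
Qed.

(** The weights of the variables: 3 for the long diagonals X_15, X_17, X_20 of the hexagon, 2 for
    the six short diagonals, and 0 for the others. *)
Definition weights := [:: 0; 0; 0; 0; 0; 2; 2; 0; 0; 2; 0; 0; 0; 0; 3; 2; 3; 2; 2; 3]%N.
Definition weight (m : 'X_{1..20}) : nat := (\sum_(i < 20) nth 0 weights i * m i)%N.

Lemma weightD m m' : weight (m + m')%MM = (weight m + weight m')%N.
Proof.
by rewrite /weight -big_split; apply: eq_bigr => i _ /=; rewrite mnmDE mulnDr.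
Qed.

Lemma weight_expt1 s : all (fun i => (0 < i <= 20)%N) s ->
  weight (expt1 19 s) = (\sum_(i <- s) nth 0 weights i.-1)%N.
Proof.
rewrite /expt1 /expt big_map; elim: s => [|i s IHs] /=; rewrite ?big_nil ?big_cons.
  by move=> _; rewrite /weight big1 // => i _; rewrite mnm0E muln0.
case/andP=> /andP[i0 i20] /IHs IH; rewrite weightD IH; congr (_ + _)%N.
rewrite /weight (bigD1 (inord i.-1)) //= mnm1E eqxx muln1 inordK ?prednK // big1 ?addn0 //.
by move=> j /negPf ji; rewrite mnm1E eq_sym ji muln0.
Qed.

Lemma weight_exchange t : t \in exchanges ->
  (weight (expt1 19 t.2.1) < weight (expt1 19 [:: t.1.1; t.1.2]))%N /\
  (weight (expt1 19 t.2.2) < weight (expt1 19 [:: t.1.1; t.1.2]))%N.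
Proof.
move=> tin; have [b1 b2 b3] := exchanges_bound tin.
have W s : (\sum_(i <- s) nth 0 weights i.-1 = sumn [seq nth 0 weights i.-1 | i <- s])%N.
  by rewrite sumnE big_map.
rewrite !weight_expt1 // !W.
have /allP h : all (fun t : exchange =>
   let w := fun s => sumn (map (fun i => nth 0 weights i.-1)%N s) in
   (w t.2.1 < w [:: t.1.1; t.1.2])%N && (w t.2.2 < w [:: t.1.1; t.1.2])%N) exchanges by [].
by have /andP[] := h t tin.
Qed.

(** A family of exponents, the exponent of g_j being e (j - 1), is noncrossing if for each
    exchange relation at least one of the exponents of X_a and X_b is 0. *)
Definition noncrossing (e : nat -> nat) : bool :=
  all (fun t : exchange => (e t.1.1.-1 == 0)%N || (e t.1.2.-1 == 0)%N) exchanges.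

Definition exponent (m : 'X_{1..20}) (j : nat) : nat := m (@inord 19 j).

Definition standard (m : 'X_{1..20}) : bool := noncrossing (exponent m).

(** A product X_a X_b that divides m is replaced by M1 + M2, which lowers the weight. *)
Lemma straighten_monomial m : exists Q : {mpoly F[20]},
  ideal_gen (TA4_rels F) ('X_[m] - Q) /\ {in msupp Q, forall m', standard m'}.
Proof.
have [n] := ubnP (weight m); elim: n m => // n IHn m; rewrite ltnS => le_mn.
have [m_std|/allPn[t tin]] := boolP (standard m).
  exists 'X_[m]; rewrite subrr; split=> [|m']; first exact: ideal_gen0.
  by rewrite msuppX mem_seq1 => /eqP->.
rewrite negb_or => /andP[ma mb].
have [b1 _ _] := exchanges_bound tin.
have t12 : t.1.1 != t.1.2.
  have /allP h : all (fun t : exchange => t.1.1 != t.1.2) exchanges by [].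
  exact: h.
pose e := expt1 19 [:: t.1.1; t.1.2].
have le_em : (e <= m)%MM.
  apply/mnm_lepP => i; rewrite /e /expt1 /expt /= !(big_cons, big_nil) !mnmDE mnm0E addn0 !mnm1E.
  have ne : (@inord 19 t.1.2.-1 == @inord 19 t.1.1.-1) = false.
    move: b1 => /= /and3P[/andP[a0 a20] /andP[b0 b20] _].
    apply/negP => /eqP/(congr1 val); rewrite /= !inordK ?prednK // => e12.
    by case/eqP: t12; rewrite -(prednK a0) -(prednK b0) e12.
  case: eqP => [<-|_]; first by rewrite ne lt0n.
  by case: eqP => [<-|_]; rewrite ?lt0n.
have wE : weight m = (weight (m - e)%MM + weight e)%N by rewrite -weightD submK.
have [w1 w2] := weight_exchange tin.
have [Q1 [I1 S1]] : exists Q : {mpoly F[20]},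
    ideal_gen (TA4_rels F) ('X_[(m - e) + expt1 19 t.2.1] - Q) /\ {in msupp Q, forall m', standard m'}.
  by apply: IHn; rewrite weightD (leq_trans _ le_mn) // wE ltn_add2l.
have [Q2 [I2 S2]] : exists Q : {mpoly F[20]},
    ideal_gen (TA4_rels F) ('X_[(m - e) + expt1 19 t.2.2] - Q) /\ {in msupp Q, forall m', standard m'}.
  by apply: IHn; rewrite weightD (leq_trans _ le_mn) // wE ltn_add2l.
exists (Q1 + Q2); split; last first.
  by move=> m' /msuppD_le; rewrite mem_cat => /orP[/S1|/S2].
have -> : 'X_[m] - (Q1 + Q2) = 'X_[m - e] * exchange_poly F t +
   (('X_[(m - e) + expt1 19 t.2.1] - Q1) + ('X_[(m - e) + expt1 19 t.2.2] - Q2)).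
  rewrite /exchange_poly /mon1 !monE -!/(expt1 _ _) -/e -{1}(submK le_em) !mpolyXD.
  ring.
by apply: ideal_genD; [exact/ideal_genM/ideal_gen_exchange | exact: ideal_genD].
Qed.

Lemma straighten P : exists Q : {mpoly F[20]},
  ideal_gen (TA4_rels F) (P - Q) /\ {in msupp Q, forall m, standard m}.
Proof.
elim/mpolyind: P => [|c m P _ _ [Q [I S]]].
  by exists 0; rewrite subr0; split; [exact: ideal_gen0 | move=> m; rewrite msupp0].
have [Qm [Im Sm]] := straighten_monomial m.
exists (c *: Qm + Q); split.
  have -> : c *: 'X_[m] + P - (c *: Qm + Q) = c%:MP * ('X_[m] - Qm) + (P - Q).
    by rewrite -!mul_mpolyC; ring.
  by apply: ideal_genD => //; apply: ideal_genM.
move=> m' /msuppD_le; rewrite mem_cat => /orP[|/S//].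
by move/msuppZ_le/Sm.
Qed.
End Standard.

(** * Linear independence by leading monomials *)

(** Nonzero polynomials with pairwise distinct leading monomials have a nonzero sum. *)
Lemma mlead_indep (K : idomainType) n (I : eqType) (s : seq I) (f : I -> {mpoly K[n]}) :
  uniq s -> (forall i, i \in s -> f i != 0) ->
  {in s &, injective (fun i => mlead (f i))} ->
  \sum_(i <- s) f i = 0 -> s = [::].
Proof.
move=> us f0 finj S0; apply/eqP/negPn/negP => s0.
suff h : s != [::] -> \sum_(i <- s) f i != 0 /\
    mlead (\sum_(i <- s) f i) \in [seq mlead (f i) | i <- s].
  by have [] := h s0; rewrite S0 eqxx.
move: s0 => _ {S0}.
elim: s us f0 finj => // i s IHs /= /andP[nis us] f0 finj _; rewrite big_cons.
have f0i : f i != 0 by apply: f0; rewrite mem_head.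
have [->|s0] := eqVneq s [::]; first by rewrite big_nil addr0 mem_head.
have [||S0 Sl] := IHs us _ _ s0.
- by move=> j js; apply: f0; rewrite inE js orbT.
- by move=> j k js ks; apply: finj; rewrite inE ?js ?ks orbT.
set S := \sum_(j <- s) f j in S0 Sl *.
have ne : mlead (f i) != mlead S.
  apply: contraNneq nis => e; have /mapP[j js ej] := Sl.
  by rewrite (finj i j) ?mem_head ?inE ?js ?orbT ?e.
split; last by rewrite mleadD //; case: leP => _; rewrite inE ?eqxx ?Sl ?orbT.
apply: contraNneq ne => /eqP; rewrite addr_eq0 => /eqP->.
by rewrite mleadN.
Qed.

(** The matrix with entries from the variables z 0, z 1, ... encoded by a table: the entry 0 of
    the table stands for 0, and k + 1 for z k. *)
Definition table (A : nzRingType) (z : nat -> A) (t : seq (seq nat)) (i j : nat) : A :=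
  if nth 0%N (nth [::] t i) j is k.+1 then z k else 0.

(** The sum of signed monomials in the z k; a monomial is a list of variables, preceded by
    [true] if its sign is negative. *)
Definition terms (A : comNzRingType) (z : nat -> A) (l : seq (bool * seq nat)) : A :=
  foldr (fun (t : bool * seq nat) p => (-1) ^+ t.1 * foldr (fun k q => z k * q) 1 t.2 + p) 0 l.

Lemma terms_cons (K : comNzRingType) n c s l :
  terms (fun k => 'X_(inord k) : {mpoly K[n.+1]}) ((c, s) :: l) =
  (if c then - 'X_[expt n s] else 'X_[expt n s]) + terms (fun k => 'X_(inord k)) l.
Proof.
rewrite /terms /= mulr_sign -monE /mon.
by rewrite (_ : foldr _ _ s = \prod_(k <- s) 'X_(inord k)) // unlock.
Qed.

(** The degree lexicographic order, on monomials of the same degree given by lists of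
    variables numbered up to n; the variable 0 is the largest. *)
Definition lexlt (n : nat) (s t : seq nat) : bool :=
  (size s == size t) && has (fun i => (count_mem i s < count_mem i t)%N &&
     all (fun j => count_mem j s == count_mem j t) (iota 0 i)) (iota 0 n.+1).

Lemma exptE n s (i : 'I_n.+1) : all (fun k => (k <= n)%N) s -> expt n s i = count_mem (i : nat) s.
Proof.
rewrite /expt; elim: s => [|k s IHs] /=; first by rewrite big_nil mnm0E.
case/andP=> kn /IHs IH; rewrite big_cons mnmDE IH mnm1E; congr (_ + _)%N.
by rewrite -val_eqE /= inordK.
Qed.

Lemma mdeg_expt n s : mdeg (expt n s) = size s.
Proof.
rewrite /expt; elim: s => [|k s IHs] /=; first by rewrite big_nil mdeg0.
by rewrite big_cons mdegD mdeg1 IHs.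
Qed.

Lemma lexlt_expt n s t : all (fun k => (k <= n)%N) s -> all (fun k => (k <= n)%N) t ->
  lexlt n s t -> (expt n s < expt n t)%O.
Proof.
move=> sn tn /andP[/eqP est hs]; case: (hasP hs) => i.
rewrite mem_iota add0n /= => i_n /andP[lti /allP eqj].
apply/ltmcP; first by rewrite !mdeg_expt.
exists (Ordinal i_n); rewrite ?exptE // => j ji; rewrite !exptE //.
by apply/eqP/eqj; rewrite mem_iota add0n.
Qed.

Lemma mlead_terms (K : idomainType) n c s (l : seq (bool * seq nat)) :
  all (fun k => (k <= n)%N) s ->
  all (fun t : bool * seq nat => all (fun k => (k <= n)%N) t.2 && lexlt n t.2 s) l ->
  let p := terms (fun k => 'X_(inord k) : {mpoly K[n.+1]}) ((c, s) :: l) in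
  p != 0 /\ mlead p = expt n s.
Proof.
move=> sn lt p; rewrite {}/p terms_cons.
set q := if c then _ else _; set r := terms _ l.
have qs : mlead q = expt n s by rewrite /q; case: c {q}; rewrite ?mleadN mleadXm.
have q0 : q != 0 by rewrite /q; case: c {qs q}; rewrite ?oppr_eq0 -msupp_eq0 msuppX.
have rl m : m \in msupp r -> (m < expt n s)%O.
  rewrite {}/r; elim: l lt => [|[d t] l IHl]; first by rewrite msupp0.
  rewrite [all _ _]/= => /andP[/andP[tn ts] /IHl{}IHl]; rewrite terms_cons.
  move/msuppD_le; rewrite mem_cat => /orP[|/IHl//].
  have -> : msupp (if d then - 'X_[expt n t] else 'X_[expt n t] : {mpoly K[n.+1]}) =i [:: expt n t].
    by move=> m'; case: d; rewrite ?(perm_mem (msuppN _)) msuppX.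
  by rewrite inE => /eqP->; apply: lexlt_expt.
have [->|r0] := eqVneq r 0; first by rewrite addr0.
have lt_rq : (mlead r < mlead q)%O by rewrite qs; apply/rl/mlead_supp.
split; last by rewrite mleadDl.
apply: contraTneq lt_rq => /eqP; rewrite addr_eq0 => /eqP->.
by rewrite mleadN ltxx.
Qed.

(** The leading monomial of a list of terms that satisfies [lead_first]. *)
Definition lead_vars (row : seq (bool * seq nat)) : seq nat := (head (false, [::]) row).2.

(** The first term is larger than the others, in thirteen variables. *)
Definition lead_first (row : seq (bool * seq nat)) : bool :=
  if row is (_, s) :: l then all (fun k => (k <= 12)%N) s &&
    all (fun t : bool * seq nat => all (fun k => (k <= 12)%N) t.2 && lexlt 12%N t.2 s) l
  else false.

(** The generators whose leading monomial involves the variable k, with multiplicities. *)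
Definition occurrences (T : seq (seq (bool * seq nat))) (k : nat) : seq nat :=
  flatten [seq nseq (count_mem k (lead_vars (nth [::] T j))) j | j <- iota 0 20].

(** The exponent of the variable k in the leading monomial of the product of the powers
    g_(j+1)^(e j); the row j of T contains the terms of g_(j+1). *)
Definition lead_degree (T : seq (seq (bool * seq nat))) (e : nat -> nat) (k : nat) : nat :=
  sumn [seq e j | j <- occurrences T k].

Lemma lead_degree_exponent T m k : lead_degree T (exponent m) k =
  (\sum_(j < 20) count_mem k (lead_vars (nth [::] T j)) * m j)%N.
Proof.
rewrite /lead_degree /occurrences map_flatten sumn_flatten -!map_comp sumnE big_map.
rewrite -[iota 0 20]/(index_iota 0 20) big_mkord; apply: eq_bigr => j _ /=.
by rewrite map_nseq sumn_nseq /exponent inord_val mulnC.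
Qed.

(** Products of powers of generators with noncrossing exponents, without the generator of
    index i, are determined by their leading monomials. *)
Definition lead_injective (T : seq (seq (bool * seq nat))) (i : nat) : Prop :=
  forall e e', noncrossing e -> noncrossing e' -> e i = 0%N -> e' i = 0%N ->
    (forall k, (k < 13)%N -> lead_degree T e k = lead_degree T e' k) ->
  forall j, (j < 20)%N -> e j = e' j.

(** A chart of the divisor of the generator of index i: a family (X, Y) of pairs of matrices,
    with the terms T of the values of the generators on it.  The row i of T is empty, and the
    other rows start with their leading term. *)
Section Chart.
Variables (F : fieldType) (X Y : seq (seq nat)) (T : seq (seq (bool * seq nat))) (i : 'I_20).
Hypothesis chartE : forall (A : comNzRingType) (z : nat -> A),
  gen_values (table z X) (table z Y) = map (terms z) T.
Hypothesis chart0 : nth [::] T i = [::].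
Hypothesis chart_lead : all (fun j => (j == i :> nat) || lead_first (nth [::] T j)) (iota 0 20).
Hypothesis chart_inj : lead_injective T i.

Let z (k : nat) : {mpoly F[13]} := 'X_(inord k).
Let phi : (4 * 4 + 4 * 4).-tuple {mpoly F[13]} :=
  mktuple (coords (\matrix_(a < 4, b < 4) table z X a b) (\matrix_(a < 4, b < 4) table z Y a b)).

Lemma chart_gens : [seq g \mPo phi | g <- TA4_gens F] = map (terms z) T.
Proof.
rewrite -chartE; apply: gens_morph => a b a4 b4 /=.
  rewrite mxE comp_mpolyXU -tnth_nth tnth_mktuple /coords row_mxEl mxvecE mxE.
  by rewrite !inordK.
rewrite mxE comp_mpolyXU -tnth_nth tnth_mktuple /coords row_mxEr mxvecE mxE.
by rewrite !inordK.
Qed.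

Lemma chart_tnth (j : 'I_20) : tnth (TA4_gens F) j \mPo phi = terms z (nth [::] T j).
Proof.
have sT : size T = 20 by have := congr1 size chart_gens; rewrite !size_map size_tuple => <-.
rewrite -(nth_map _ 0) ?sT // -chart_gens (nth_map 0) ?size_tuple //.
by rewrite -tnth_nth.
Qed.

(** Standard monomials without the generator of index i are linearly independent modulo that
    generator, as their restrictions to the chart have distinct leading monomials. *)
Lemma chart_indep (Q : {mpoly F[20]}) (f : polyMM F 4) :
  {in msupp Q, forall m, standard m /\ m i = 0%N} ->
  Q \mPo TA4_gens F = tnth (TA4_gens F) i * f -> Q = 0.
Proof.
move=> Qstd /(congr1 (comp_mpoly phi)).
rewrite rmorphM /= chart_tnth chart0 [terms z [::]]/(0 : {mpoly F[13]}) mul0r (comp_mpolyEX Q) raddf_sum /=.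
pose G j := terms z (nth [::] T j).
have GE m : (Q@_m *: ('X_[m] \mPo TA4_gens F)) \mPo phi = Q@_m *: \prod_(j < 20) G j ^+ m j.
  rewrite comp_mpolyZ comp_mpolyX rmorph_prod; congr (_ *: _).
  by apply: eq_bigr => j _; rewrite rmorphXn /= chart_tnth.
under eq_bigr do rewrite GE.
have Gj (j : 'I_20) : j != i -> G j != 0 /\ mlead (G j) = expt 12 (lead_vars (nth [::] T j)).
  move=> ji; have /allP/(_ (j : nat)) := chart_lead.
  have /negPf -> : (j != i :> nat) by [].
  rewrite mem_iota ltn_ord => /(_ isT) /=.
  rewrite /G; case: (nth _ _ _) => // -[c s] l /andP[]; exact: mlead_terms.
have G0 m (j : 'I_20) : m \in msupp Q -> G j ^+ m j != 0.
  move/Qstd => [_ mi]; have [->|/Gj[Gj0 _]] := eqVneq j i; first by rewrite mi oner_eq0.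
  exact: expf_neq0.
have Q0 m : m \in msupp Q -> Q@_m != 0 by rewrite mcoeff_msupp.
have row_vars (j : 'I_20) : all (fun k => (k <= 12)%N) (lead_vars (nth [::] T j)).
  have [->|ji] := eqVneq j i; first by rewrite chart0.
  have /allP/(_ (j : nat)) := chart_lead; have /negPf -> : (j != i :> nat) by [].
  rewrite mem_iota ltn_ord => /(_ isT) /=.
  by rewrite /lead_first /lead_vars; case: (nth _ _ _) => // -[c s] l /andP[].
have lead m (k : 'I_13) : m \in msupp Q ->
    mlead (Q@_m *: \prod_(j < 20) G j ^+ m j) k = lead_degree T (exponent m) k.
  move=> mQ; rewrite mleadZ ?Q0 // mlead_prod => [|j _ _]; last exact: G0.
  rewrite mnm_sumE lead_degree_exponent; apply: eq_bigr => j _; have [_ mi] := Qstd m mQ.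
  have [->|/Gj[Gj0 lGj]] := eqVneq j i; first by rewrite mi muln0 expr0 mlead1 mnm0E.
  by rewrite mleadX // lGj mulmnE exptE.
move/mlead_indep => /(_ (msupp_uniq Q)) Qnil; apply/eqP; rewrite -msupp_eq0; apply/eqP/Qnil.
  move=> m mQ; rewrite scaler_eq0 negb_or Q0 //=; apply/prodf_neq0 => j _; exact: G0.
move=> m m' mQ m'Q /= e; have [sm mi] := Qstd m mQ; have [sm' mi'] := Qstd m' m'Q.
apply/mnmP => j; rewrite -(inord_val j).
apply: (chart_inj (e := exponent m) (e' := exponent m')) => //.
- by rewrite /exponent inord_val.
- by rewrite /exponent inord_val.
by move=> k k13; rewrite -!(lead _ (Ordinal k13)) // e.
Qed.
End Chart.

(** * Charts of the six pivot divisors *)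

(** The nine variables in crossing pairs, and their fourteen maximal noncrossing subsets. *)
Definition mutable := [:: 6; 7; 10; 15; 16; 17; 18; 19; 20]%N.
Definition clusters :=
  [:: [:: 6; 7; 10]; [:: 6; 7; 20]; [:: 6; 10; 17]; [:: 6; 17; 19]; [:: 6; 19; 20];
      [:: 7; 10; 15]; [:: 7; 15; 18]; [:: 7; 18; 20]; [:: 10; 15; 16]; [:: 10; 16; 17];
      [:: 15; 16; 18]; [:: 16; 17; 19]; [:: 16; 18; 19]; [:: 18; 19; 20]]%N.

(** Noncrossing exponents of the mutable variables are supported on a cluster.  The statement
    reduces by computation to a disjunction of conjunctions of equations e j = 0. *)
Lemma noncrossing_cluster (e : nat -> nat) : noncrossing e ->
  foldr (fun c P => foldr (fun j Q => if j \in c then Q else e j.-1 = 0%N /\ Q) True mutable \/ P)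
    False clusters.
Proof.
move=> h.
have : has (fun c : seq nat => all (fun j => (j \in c) || (e j.-1 == 0)%N) mutable) clusters.
  move: h; rewrite /noncrossing /=.
  by case: (e 5 == 0)%N; case: (e 6 == 0)%N; case: (e 9 == 0)%N; case: (e 14 == 0)%N;
    case: (e 15 == 0)%N; case: (e 16 == 0)%N; case: (e 17 == 0)%N; case: (e 18 == 0)%N;
    case: (e 19 == 0)%N.
move: mutable clusters => M; elim=> //= c cs IHcs /orP[hc|/IHcs]; [left; move: hc|by right].
elim: M {IHcs} => //= j js IHjs /andP[]; case: ifP => /= _; first by move=> _ /IHjs.
by move/eqP => -> /IHjs.
Qed.

(* The minors are expanded before the tables are substituted for x and y. *)
Ltac chart_values :=
  rewrite /gen_values /minor;
  let x := fresh in let Ex := fresh in let y := fresh in let Ey := fresh in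
  move Ex: (table _ _) => x; move Ey: (table _ _) => y;
  rewrite /=; rewrite -{}Ex -{}Ey /table /=;
  do 14 (congr cons; first by ring); congr [:: _; _; _; _; _; _]; ring.

(* Writes out the thirteen equations between exponents of H. *)
Ltac lead_equations H :=
  move: (H 0 isT) (H 1 isT) (H 2 isT) (H 3 isT) (H 4 isT) (H 5 isT) (H 6 isT) (H 7 isT)
    (H 8 isT) (H 9 isT) (H 10 isT) (H 11 isT) (H 12 isT)%N => {H};
  rewrite /lead_degree;
  repeat match goal with
    |- context [occurrences ?T ?k] =>
      let v := eval vm_compute in (occurrences T k) in change (occurrences T k) with v
  end;
  cbn [map sumn foldr]; do 13 (let h := fresh "H" in move=> h).

(* The equations E1, E2 and E3 are combinations of the lead equations that involve only the nine
   exponents of the mutable generators.  For each pair of clusters supporting e and e', they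
   force these exponents to agree; the lead equations then determine the ten remaining ones. *)
Ltac compare_clusters e e' ce ce' E1 E2 E3 :=
  have : (e 5 = e' 5 /\ e 6 = e' 6 /\ e 9 = e' 9 /\ e 14 = e' 14 /\ e 15 = e' 15 /\
      e 16 = e' 16 /\ e 17 = e' 17 /\ e 18 = e' 18 /\ e 19 = e' 19)%N;
  [ move: ce ce' E1 E2 E3; clear;
    move: (e 5) (e 6) (e 9) (e 14) (e 15) (e 16) (e 17) (e 18) (e 19)%N;
    move: (e' 5) (e' 6) (e' 9) (e' 14) (e' 15) (e' 16) (e' 17) (e' 18) (e' 19)%N;
    intros;
    repeat match goal with H : _ \/ _ |- _ => destruct H end;
    repeat match goal with H : _ /\ _ |- _ => destruct H end;
    try contradiction; subst; lia
  | case=> ? [? [? [? [? [? [? [? ?]]]]]]]; clear ce ce' E1 E2 E3;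
    do 20 (case; first by lia); by [] ].

(** The chart of the divisor where the entry y_11, the generator g_1, vanishes. *)
Definition chart1_x := [:: [:: 1; 0; 0; 0]; [:: 0; 2; 0; 0]; [:: 0; 0; 3; 0]; [:: 0; 0; 0; 4]]%N.
Definition chart1_y := [:: [:: 0; 5; 0; 0]; [:: 6; 0; 0; 0]; [:: 7; 8; 9; 0]; [:: 10; 11; 12; 13]]%N.
Definition chart1 : seq (seq (bool * seq nat)) :=
  [:: [::]; [:: (true, [:: 4; 5])]; [:: (true, [:: 4; 5; 8])];
      [:: (true, [:: 4; 5; 8; 12])]; [:: (false, [:: 0])]; [:: (false, [:: 0; 5])];
      [:: (false, [:: 0; 5; 7])]; [:: (false, [:: 0; 5; 7; 11]); (true, [:: 0; 5; 8; 10])];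
      [:: (false, [:: 0; 1])]; [:: (false, [:: 0; 1; 6])];
      [:: (false, [:: 0; 1; 6; 10]); (true, [:: 0; 1; 7; 9])]; [:: (false, [:: 0; 1; 2])];
      [:: (false, [:: 0; 1; 2; 9])]; [:: (false, [:: 0; 1; 2; 3])];
      [:: (true, [:: 0; 1; 4; 6])];
      [:: (true, [:: 0; 1; 4; 6; 11]); (false, [:: 0; 1; 4; 8; 9])];
      [:: (true, [:: 0; 1; 4; 5; 6; 11]); (false, [:: 0; 1; 4; 5; 8; 9])];
      [:: (true, [:: 0; 1; 2; 4; 9])]; [:: (true, [:: 0; 1; 2; 4; 5; 11])];
      [:: (false, [:: 0; 0; 1; 2; 5; 10])]]%N.

Lemma chart1_values (A : comNzRingType) (z : nat -> A) :
  gen_values (table z chart1_x) (table z chart1_y) = map (terms z) chart1.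
Proof. by chart_values. Qed.

Lemma chart1_inj : lead_injective chart1 0%N.
Proof.
move=> e e' /noncrossing_cluster/= ce /noncrossing_cluster/= ce' e0 e0' H.
lead_equations H.
have E1 : (e 5 + e 19 + e' 14 + e' 15 + e' 17
    = e' 5 + e' 19 + e 14 + e 15 + e 17)%N by clear ce ce'; lia.
have E2 : (e 6 + e' 15 + e' 16 + e' 18
    = e' 6 + e 15 + e 16 + e 18)%N by clear ce ce'; lia.
have E3 : (e 9 + e 14 + e 15 + e 16 + e' 19
    = e' 9 + e' 14 + e' 15 + e' 16 + e 19)%N by clear ce ce'; lia.
compare_clusters e e' ce ce' E1 E2 E3.
Qed.

(** The chart of the divisor g_2 = 0, with y_22 = 0 after elimination. *)
Definition chart2_x := [:: [:: 1; 0; 0; 0]; [:: 0; 2; 0; 0]; [:: 0; 0; 3; 0]; [:: 0; 0; 0; 4]]%N.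
Definition chart2_y := [:: [:: 5; 0; 0; 0]; [:: 6; 0; 7; 0]; [:: 8; 9; 0; 0]; [:: 10; 11; 12; 13]]%N.
Definition chart2 : seq (seq (bool * seq nat)) :=
  [:: [:: (false, [:: 4])]; [::]; [:: (true, [:: 4; 6; 8])]; [:: (true, [:: 4; 6; 8; 12])];
      [:: (false, [:: 0])]; [:: (false, [:: 0; 5])]; [:: (false, [:: 0; 5; 8])];
      [:: (false, [:: 0; 5; 8; 11]); (false, [:: 0; 6; 7; 10]); (true, [:: 0; 6; 8; 9])];
      [:: (false, [:: 0; 1])]; [:: (false, [:: 0; 1; 7])];
      [:: (false, [:: 0; 1; 7; 10]); (true, [:: 0; 1; 8; 9])]; [:: (false, [:: 0; 1; 2])];
      [:: (false, [:: 0; 1; 2; 9])]; [:: (false, [:: 0; 1; 2; 3])];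
      [:: (false, [:: 0; 1; 4; 8])]; [:: (false, [:: 0; 1; 4; 8; 11])];
      [:: (true, [:: 0; 1; 4; 6; 7; 10]); (false, [:: 0; 1; 4; 6; 8; 9])];
      [:: (false, [:: 0; 1; 2; 4; 10])]; [:: (true, [:: 0; 1; 2; 4; 6; 10])];
      [:: (false, [:: 0; 0; 1; 2; 5; 10])]]%N.

Lemma chart2_values (A : comNzRingType) (z : nat -> A) :
  gen_values (table z chart2_x) (table z chart2_y) = map (terms z) chart2.
Proof. by chart_values. Qed.

Lemma chart2_inj : lead_injective chart2 1%N.
Proof.
move=> e e' /noncrossing_cluster/= ce /noncrossing_cluster/= ce' e0 e0' H.
lead_equations H.
have E1 : (e 5 + e 16 + e 18 + e 19 + e' 14 + e' 15
    = e' 5 + e' 16 + e' 18 + e' 19 + e 14 + e 15)%N by clear ce ce'; lia.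
have E2 : (e 6 + e 14 + e' 16 + e' 18
    = e' 6 + e' 14 + e 16 + e 18)%N by clear ce ce'; lia.
have E3 : (e 9 + e' 17 + e' 18 + e' 19
    = e' 9 + e 17 + e 18 + e 19)%N by clear ce ce'; lia.
compare_clusters e e' ce ce' E1 E2 E3.
Qed.

(** The chart of the divisor g_3 = 0, with y_33 = 0 after elimination. *)
Definition chart3_x := [:: [:: 1; 0; 0; 0]; [:: 0; 2; 0; 0]; [:: 0; 0; 3; 0]; [:: 0; 0; 0; 4]]%N.
Definition chart3_y := [:: [:: 5; 0; 0; 0]; [:: 6; 7; 0; 0]; [:: 8; 9; 0; 10]; [:: 11; 12; 13; 0]]%N.
Definition chart3 : seq (seq (bool * seq nat)) :=
  [:: [:: (false, [:: 4])]; [:: (false, [:: 4; 6])]; [::]; [:: (true, [:: 4; 6; 9; 12])];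
      [:: (false, [:: 0])]; [:: (false, [:: 0; 5])];
      [:: (false, [:: 0; 5; 8]); (true, [:: 0; 6; 7])];
      [:: (false, [:: 0; 5; 8; 12]); (true, [:: 0; 6; 7; 12])]; [:: (false, [:: 0; 1])];
      [:: (false, [:: 0; 1; 7])]; [:: (false, [:: 0; 1; 7; 11]); (true, [:: 0; 1; 8; 10])];
      [:: (false, [:: 0; 1; 2])]; [:: (false, [:: 0; 1; 2; 10])];
      [:: (false, [:: 0; 1; 2; 3])]; [:: (false, [:: 0; 1; 4; 8])];
      [:: (false, [:: 0; 1; 4; 8; 12])]; [:: (false, [:: 0; 1; 4; 6; 7; 12])];
      [:: (false, [:: 0; 1; 2; 4; 11])]; [:: (false, [:: 0; 1; 2; 4; 6; 12])];
      [:: (false, [:: 0; 0; 1; 2; 5; 11]); (true, [:: 0; 0; 1; 2; 6; 10])]]%N.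

Lemma chart3_values (A : comNzRingType) (z : nat -> A) :
  gen_values (table z chart3_x) (table z chart3_y) = map (terms z) chart3.
Proof. by chart_values. Qed.

Lemma chart3_inj : lead_injective chart3 2%N.
Proof.
move=> e e' /noncrossing_cluster/= ce /noncrossing_cluster/= ce' e0 e0' H.
lead_equations H.
have E1 : (e 5 + e 19 + e' 14 + e' 15
    = e' 5 + e' 19 + e 14 + e 15)%N by clear ce ce'; lia.
have E2 : (e 6 + e 14 + e' 16 + e' 18
    = e' 6 + e' 14 + e 16 + e 18)%N by clear ce ce'; lia.
have E3 : (e 9 + e 16 + e' 17 + e' 19
    = e' 9 + e' 16 + e 17 + e 19)%N by clear ce ce'; lia.
compare_clusters e e' ce ce' E1 E2 E3.
Qed.

(** The charts of the divisors g_5 = 0, g_9 = 0 and g_12 = 0 are obtained from the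
    first three by exchanging x and y. *)
Definition chart5_x := [:: [:: 0; 1; 0; 0]; [:: 2; 0; 0; 0]; [:: 3; 4; 5; 0]; [:: 6; 7; 8; 9]]%N.
Definition chart5_y := [:: [:: 10; 0; 0; 0]; [:: 0; 11; 0; 0]; [:: 0; 0; 12; 0]; [:: 0; 0; 0; 13]]%N.
Definition chart5 : seq (seq (bool * seq nat)) :=
  [:: [:: (false, [:: 9])]; [:: (false, [:: 9; 10])]; [:: (false, [:: 9; 10; 11])];
      [:: (false, [:: 9; 10; 11; 12])]; [::]; [:: (true, [:: 1; 9])];
      [:: (false, [:: 2; 9; 10])]; [:: (true, [:: 5; 9; 10; 11])]; [:: (true, [:: 0; 1])];
      [:: (false, [:: 1; 3; 9])]; [:: (false, [:: 2; 6; 9; 10]); (true, [:: 3; 5; 9; 10])];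
      [:: (true, [:: 0; 1; 4])]; [:: (true, [:: 1; 3; 7; 9]); (false, [:: 1; 4; 6; 9])];
      [:: (true, [:: 0; 1; 4; 8])]; [:: (false, [:: 0; 2; 9; 10])];
      [:: (true, [:: 0; 5; 9; 10; 11])]; [:: (true, [:: 1; 6; 9; 9; 10; 11])];
      [:: (true, [:: 0; 2; 7; 9; 10]); (false, [:: 0; 4; 5; 9; 10])];
      [:: (false, [:: 0; 1; 7; 9; 10; 11])];
      [:: (false, [:: 0; 1; 2; 7; 9; 10]); (true, [:: 0; 1; 4; 5; 9; 10])]]%N.

Lemma chart5_values (A : comNzRingType) (z : nat -> A) :
  gen_values (table z chart5_x) (table z chart5_y) = map (terms z) chart5.
Proof. by chart_values. Qed.

Lemma chart5_inj : lead_injective chart5 4%N.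
Proof.
move=> e e' /noncrossing_cluster/= ce /noncrossing_cluster/= ce' e0 e0' H.
lead_equations H.
have E1 : (e 5 + e 16 + e' 14 + e' 15 + e' 17
    = e' 5 + e' 16 + e 14 + e 15 + e 17)%N by clear ce ce'; lia.
have E2 : (e 6 + e 14 + e 17 + e 19 + e' 16
    = e' 6 + e' 14 + e' 17 + e' 19 + e 16)%N by clear ce ce'; lia.
have E3 : (e 9 + e' 17 + e' 18 + e' 19
    = e' 9 + e 17 + e 18 + e 19)%N by clear ce ce'; lia.
compare_clusters e e' ce ce' E1 E2 E3.
Qed.

Definition chart9_x := [:: [:: 1; 0; 0; 0]; [:: 2; 0; 3; 0]; [:: 4; 5; 0; 0]; [:: 6; 7; 8; 9]]%N.
Definition chart9_y := [:: [:: 10; 0; 0; 0]; [:: 0; 11; 0; 0]; [:: 0; 0; 12; 0]; [:: 0; 0; 0; 13]]%N.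
Definition chart9 : seq (seq (bool * seq nat)) :=
  [:: [:: (false, [:: 9])]; [:: (false, [:: 9; 10])]; [:: (false, [:: 9; 10; 11])];
      [:: (false, [:: 9; 10; 11; 12])]; [:: (false, [:: 0])]; [:: (true, [:: 1; 9])];
      [:: (false, [:: 3; 9; 10])]; [:: (true, [:: 5; 9; 10; 11])]; [::];
      [:: (false, [:: 1; 4; 9])]; [:: (false, [:: 3; 6; 9; 10]); (true, [:: 4; 5; 9; 10])];
      [:: (true, [:: 0; 2; 4])];
      [:: (true, [:: 1; 4; 7; 9]); (true, [:: 2; 3; 6; 9]); (false, [:: 2; 4; 5; 9])];
      [:: (true, [:: 0; 2; 4; 8])]; [:: (true, [:: 0; 4; 9; 10])];
      [:: (false, [:: 0; 6; 9; 10; 11])]; [:: (true, [:: 1; 6; 9; 9; 10; 11])];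
      [:: (false, [:: 0; 4; 7; 9; 10])]; [:: (false, [:: 0; 2; 6; 9; 10; 11])];
      [:: (false, [:: 0; 2; 3; 6; 9; 10]); (true, [:: 0; 2; 4; 5; 9; 10])]]%N.

Lemma chart9_values (A : comNzRingType) (z : nat -> A) :
  gen_values (table z chart9_x) (table z chart9_y) = map (terms z) chart9.
Proof. by chart_values. Qed.

Lemma chart9_inj : lead_injective chart9 8%N.
Proof.
move=> e e' /noncrossing_cluster/= ce /noncrossing_cluster/= ce' e0 e0' H.
lead_equations H.
have E1 : (e 5 + e 16 + e 18 + e 19 + e' 14 + e' 17
    = e' 5 + e' 16 + e' 18 + e' 19 + e 14 + e 17)%N by clear ce ce'; lia.
have E2 : (e 6 + e' 15 + e' 16 + e' 18
    = e' 6 + e 15 + e 16 + e 18)%N by clear ce ce'; lia.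
have E3 : (e 9 + e 14 + e' 18 + e' 19
    = e' 9 + e' 14 + e 18 + e 19)%N by clear ce ce'; lia.
compare_clusters e e' ce ce' E1 E2 E3.
Qed.

Definition chart12_x := [:: [:: 1; 0; 0; 0]; [:: 2; 3; 0; 0]; [:: 4; 5; 0; 6]; [:: 7; 8; 9; 0]]%N.
Definition chart12_y := [:: [:: 10; 0; 0; 0]; [:: 0; 11; 0; 0]; [:: 0; 0; 12; 0]; [:: 0; 0; 0; 13]]%N.
Definition chart12 : seq (seq (bool * seq nat)) :=
  [:: [:: (false, [:: 9])]; [:: (false, [:: 9; 10])]; [:: (false, [:: 9; 10; 11])];
      [:: (false, [:: 9; 10; 11; 12])]; [:: (false, [:: 0])]; [:: (true, [:: 1; 9])];
      [:: (false, [:: 3; 9; 10])]; [:: (true, [:: 6; 9; 10; 11])]; [:: (false, [:: 0; 2])];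
      [:: (false, [:: 1; 4; 9]); (true, [:: 2; 3; 9])];
      [:: (false, [:: 3; 7; 9; 10]); (true, [:: 4; 6; 9; 10])]; [::];
      [:: (true, [:: 1; 4; 8; 9]); (false, [:: 2; 3; 8; 9])]; [:: (true, [:: 0; 2; 5; 8])];
      [:: (true, [:: 0; 4; 9; 10])]; [:: (false, [:: 0; 7; 9; 10; 11])];
      [:: (true, [:: 1; 7; 9; 9; 10; 11]); (false, [:: 2; 6; 9; 9; 10; 11])];
      [:: (false, [:: 0; 4; 8; 9; 10])]; [:: (true, [:: 0; 2; 8; 9; 10; 11])];
      [:: (true, [:: 0; 2; 3; 8; 9; 10])]]%N.

Lemma chart12_values (A : comNzRingType) (z : nat -> A) :
  gen_values (table z chart12_x) (table z chart12_y) = map (terms z) chart12.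
Proof. by chart_values. Qed.

Lemma chart12_inj : lead_injective chart12 11%N.
Proof.
move=> e e' /noncrossing_cluster/= ce /noncrossing_cluster/= ce' e0 e0' H.
lead_equations H.
have E1 : (e 5 + e 16 + e' 14 + e' 17
    = e' 5 + e' 16 + e 14 + e 17)%N by clear ce ce'; lia.
have E2 : (e 6 + e 19 + e' 15 + e' 16
    = e' 6 + e' 19 + e 15 + e 16)%N by clear ce ce'; lia.
have E3 : (e 9 + e 14 + e' 18 + e' 19
    = e' 9 + e' 14 + e 18 + e 19)%N by clear ce ce'; lia.
compare_clusters e e' ce ce' E1 E2 E3.
Qed.

(** * Saturation, and the presentation of the algebra *)

Section Final.
Variable F : fieldType.
Hypothesis F0 : injective (fun n : nat => n%:R : F).

(** For a pivot g_i, the standard monomials in the other generators are linearly independent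
    modulo g_i in the polynomial ring. *)
Lemma pivot_indep (i : 'I_20) (Q : {mpoly F[20]}) (f : polyMM F 4) : (i : nat) \in pivots ->
  {in msupp Q, forall m, standard m /\ m i = 0%N} ->
  Q \mPo TA4_gens F = tnth (TA4_gens F) i * f -> Q = 0.
Proof.
rewrite !inE => /or4P[/eqP i_|/eqP i_|/eqP i_|/or3P[]/eqP i_].
- by apply: (chart_indep chart1_values); rewrite ?i_ //; apply: chart1_inj.
- by apply: (chart_indep chart2_values); rewrite ?i_ //; apply: chart2_inj.
- by apply: (chart_indep chart3_values); rewrite ?i_ //; apply: chart3_inj.
- by apply: (chart_indep chart5_values); rewrite ?i_ //; apply: chart5_inj.
- by apply: (chart_indep chart9_values); rewrite ?i_ //; apply: chart9_inj.
- by apply: (chart_indep chart12_values); rewrite ?i_ //; apply: chart12_inj.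
Qed.

Lemma standard_sub (m m' : 'X_{1..20}) : (forall j, (m' j <= m j)%N) -> standard m -> standard m'.
Proof.
move=> le /allP sm; apply/allP => t /sm /orP[] e0; apply/orP; [left|right];
  by move: e0; rewrite /exponent -!leqn0; apply: leq_trans.
Qed.

(** A standard combination is X_i times a standard combination, plus a standard combination of
    monomials that X_i does not divide. *)
Lemma standard_split (i : 'I_20) (Q : {mpoly F[20]}) : {in msupp Q, forall m, standard m} ->
  exists Q0 Q1, [/\ Q = 'X_i * Q1 + Q0, {in msupp Q0, forall m, standard m /\ m i = 0%N} &
    {in msupp Q1, forall m, standard m}].
Proof.
elim/mpolyind: Q => [|c m Q mQ c0 IHQ] Qstd.
  by exists 0, 0; rewrite mulr0 addr0; split=> // m; rewrite msupp0.
have Qm : {in msupp Q, forall m, standard m} /\ standard m.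
  have supp : msupp (c *: 'X_[m] + Q) =i m :: msupp Q.
    move=> m'; rewrite inE !mcoeff_msupp mcoeffD mcoeffZ mcoeffX.
    have [->|ne] := eqVneq m' m; last by rewrite mulr0 add0r.
    by rewrite mulr1 (memN_msupp_eq0 mQ) addr0.
  by split=> [m' m'Q|]; apply: Qstd; rewrite supp inE ?m'Q ?orbT ?eqxx.
case: Qm => /IHQ[Q0 [Q1 [QE S0 S1]]] sm.
have [mi|mi] := eqVneq (m i) 0%N.
  exists (c *: 'X_[m] + Q0), Q1; split=> //; first by rewrite QE addrCA.
  move=> m' /msuppD_le; rewrite mem_cat => /orP[/msuppZ_le|/S0//].
  by rewrite msuppX inE => /eqP->.
have le_im : (U_(i) <= m)%MM by rewrite lep1mP.
exists Q0, (c *: 'X_[m - U_(i)] + Q1); split=> //.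
  by rewrite mulrDr -scalerAr -mpolyXD addmC submK // -addrA -QE.
move=> m' /msuppD_le; rewrite mem_cat => /orP[/msuppZ_le|/S1//].
rewrite msuppX inE => /eqP->; apply: standard_sub sm => j.
by rewrite mnmBE leq_subr.
Qed.

Lemma ideal_gens P : ideal_gen (TA4_rels F) P -> P \mPo TA4_gens F = 0.
Proof.
case=> c ->; rewrite rmorph_sum big1 // => j _; rewrite rmorphM /=.
suff -> : tnth (TA4_rels F) j \mPo TA4_gens F = 0 by rewrite mulr0.
have := mem_tnth j (TA4_rels F); rewrite memtE rels_exchange mem_cat.
by case/orP=> /mapP[t tin ->]; rewrite ?comp_mpolyN (exchange_gens F0) ?oppr0 //;
  [apply: mem_take tin | apply: mem_drop tin].
Qed.

Lemma pivot_prod_gens : pivot_prod F \mPo TA4_gens F =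
  tnth (TA4_gens F) (inord 0) * (tnth (TA4_gens F) (inord 1) * (tnth (TA4_gens F) (inord 2) *
  (tnth (TA4_gens F) (inord 4) * (tnth (TA4_gens F) (inord 8) * tnth (TA4_gens F) (inord 11))))).
Proof.
rewrite /pivot_prod /mon1 /mon /= !(big_cons, big_nil) mulr1 !rmorphM /=.
by rewrite !comp_mpolyXU -!tnth_nth.
Qed.

Lemma pivot_neq0 (i : 'I_20) : (i : nat) \in pivots -> tnth (TA4_gens F) i != 0.
Proof.
move=> ip; have := pivot_prod_neq0 F; rewrite pivot_prod_gens !mulf_eq0 !negb_or.
rewrite -(inord_val i); move: (i : nat) ip => k.
by rewrite !inE => /or4P[/eqP->|/eqP->|/eqP->|/or3P[]/eqP->] /and5P[? ? ? ? /andP[]].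
Qed.

(** A polynomial that a pivot multiplies into the subalgebra lies in the subalgebra. *)
Lemma pivot_saturated (i : 'I_20) (f : polyMM F 4) : (i : nat) \in pivots ->
  subalgebra_gen (TA4_gens F) (tnth (TA4_gens F) i * f) -> subalgebra_gen (TA4_gens F) f.
Proof.
move=> ip [P PE]; have [Q [IQ /(standard_split i)[Q0 [Q1 [QE S0 S1]]]]] := straighten P.
have PQ : P \mPo TA4_gens F = Q \mPo TA4_gens F.
  by apply/eqP; rewrite -subr_eq0 -comp_mpolyB (ideal_gens IQ).
have XE : 'X_i \mPo TA4_gens F = tnth (TA4_gens F) i by rewrite comp_mpolyXU -tnth_nth.
have Q00 : Q0 = 0.
  apply: (pivot_indep (f := f - (Q1 \mPo TA4_gens F)) ip S0).
  by rewrite mulrBr PE PQ QE comp_mpolyD rmorphM /= XE addrC addKr.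
exists Q1; apply: (mulfI (pivot_neq0 ip)).
by rewrite PE PQ QE Q00 addr0 rmorphM /= XE.
Qed.

(** By the case i = 1 of [pivot_indep], a vanishing standard combination is divisible by X_1; the
    quotient vanishes too, and has smaller degree. *)
Lemma standard_indep (Q : {mpoly F[20]}) : {in msupp Q, forall m, standard m} ->
  Q \mPo TA4_gens F = 0 -> Q = 0.
Proof.
have [n] := ubnP (msize Q); elim: n Q => // n IHn Q; rewrite ltnS => le_Qn.
move/(standard_split (inord 0 : 'I_20)) => [Q0 [Q1 [QE S0 S1]]].
set i := inord 0 in QE S0; have ip : (i : nat) \in pivots by rewrite inordK.
have XE : 'X_i \mPo TA4_gens F = tnth (TA4_gens F) i by rewrite comp_mpolyXU -tnth_nth.
move=> Qg; have Q00 : Q0 = 0.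
  apply: (pivot_indep (f := - (Q1 \mPo TA4_gens F)) ip S0).
  by move: Qg; rewrite QE comp_mpolyD rmorphM /= XE mulrN => /eqP; rewrite addrC addr_eq0 => /eqP.
rewrite {}Q00 addr0 in QE; suff Q10 : Q1 = 0 by rewrite QE Q10 mulr0.
have Q1g : Q1 \mPo TA4_gens F = 0.
  by apply: (mulfI (pivot_neq0 ip)); rewrite mulr0 -XE -rmorphM /= -QE.
have [//|Q1n0] := eqVneq Q1 0; apply: IHn => //.
have X0 : 'X_i != 0 :> {mpoly F[20]} by rewrite -msupp_eq0 msuppX.
by rewrite (leq_trans _ le_Qn) // QE msizeM // msizeX mdeg1.
Qed.

Lemma TA_generated (f : polyMM F 4) : TA f -> subalgebra_gen (TA4_gens F) f.
Proof.
case/(TA_localized F0) => D; rewrite pivot_prod_gens.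
have gP (i : 'I_20) : (i : nat) \in pivots -> forall h,
    subalgebra_gen (TA4_gens F) (tnth (TA4_gens F) i * h) -> subalgebra_gen (TA4_gens F) h.
  by move=> ip h; apply: pivot_saturated.
elim: D => [|D IHD]; first by rewrite expr0 mul1r.
rewrite exprS => h; apply: IHD; move: h; rewrite -!mulrA.
by do 6 (move/gP; rewrite inordK // => /(_ isT)).
Qed.

Lemma relations_generate P : P \mPo TA4_gens F = 0 -> ideal_gen (TA4_rels F) P.
Proof.
move=> Pg; have [Q [IQ SQ]] := straighten P.
have Qg : Q \mPo TA4_gens F = 0.
  by have := ideal_gens IQ; rewrite comp_mpolyB Pg sub0r => /eqP; rewrite oppr_eq0 => /eqP.
by move: IQ; rewrite (standard_indep SQ Qg) subr0.
Qed.
End Final.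

Theorem theorem3p7 (R : realType) :
  (forall f : polyMM R[i] 4,
     @TA R[i] 4 f <-> subalgebra_gen (TA4_gens R[i]) f) /\
  (forall P : {mpoly R[i][20]},
     (P \mPo TA4_gens R[i])%R = 0%R <-> ideal_gen (TA4_rels R[i]) P).
Proof.
have F0 : injective (fun n : nat => n%:R : R[i]).
  by move=> a b /eqP; rewrite Num.Theory.eqr_nat => /eqP.
split=> [f|P]; split.
- exact: TA_generated.
- by case=> P ->; apply: subalgebra_TA.
- exact: relations_generate.
- exact: ideal_gens.
Qed.
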